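(* Let $\mathfrak{X}$ be a transitive saturated fusion action system of a finite $p$-group $S$ on a finite set $X$, and let $x\in X$ be fully stabilized. Then the stabilizer fusion action system $\mathfrak{X}_x$ is also saturated.
   Context: Let $p$ be a prime, $S$ a finite $p$-group, and $X$ a finite set with a left $S$-action; $\Sigma_X$ is the symmetric group on $X$, $\ell_s\in\Sigma_X$ is the permutation $x\mapsto s\cdot x$, and $c_s$ is conjugation $h\mapsto shs^{-1}$. $\mathrm{Inj}(P,Q)$ is the set of injective homomorphisms $P\to Q$. A pair $(\varphi,\sigma)\in\mathrm{Inj}(P,Q)\times\Sigma_X$ ($P,Q\le S$) is intertwined if $\sigma\ell_p\sigma^{-1}=\ell_{\varphi(p)}$ for all $p\in P$. Let $\mathfrak{U}$ be the category whose objects are all subgroups of $S$, whose morphisms $P\to Q$ are the intertwined pairs, composed componentwise. Let $\mathfrak{X}_S\subseteq\mathfrak{U}$ have the same objects and morphisms $P\to Q$ the pairs $(c_s|_P,\ell_s)$ with $s\in S$, $sPs^{-1}\le Q$. A fusion action system of $S$ on $X$ is a category $\mathfrak{X}$ with $\mathfrak{X}_S\subseteq\mathfrak{X}\subseteq\mathfrak{U}$ such that every morphism of $\mathfrak{X}$ factors as an isomorphism of $\mathfrak{X}$ followed by an inclusion $(\mathrm{incl},\mathrm{id}_X)$. Write $\mathfrak{X}(P)=\mathfrak{X}(P,P)$ and $\mathfrak{X}(P,Q)_{\mathrm{iso}}$ for the isomorphisms; $\mathfrak{X}(1)$ is identified with a subgroup of $\Sigma_X$. The underlying fusion system $\mathcal{F}^{\mathfrak{X}}$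 has the subgroups of $S$ as objects and $\mathcal{F}^{\mathfrak{X}}(P,Q)=\{\varphi : \exists\sigma,\ (\varphi,\sigma)\in\mathfrak{X}(P,Q)\}$; two subgroups are conjugate if they are isomorphic in $\mathcal{F}^{\mathfrak{X}}$. Let $C=\{s\in S:\ell_s=\mathrm{id}_X\}$, $N_S(P;X)=N_S(P)\cap C$, $Z_S(P;X)=Z_S(P)\cap C$. A subgroup $P\le S$ is fully normalized (resp. fully centralized, fully $X$-normalized, fully $X$-centralized) if $|N_S(P)|\ge|N_S(Q)|$ (resp. the same inequality for $Z_S(-)$, $N_S(-;X)$, $Z_S(-;X)$) for all $Q$ conjugate to $P$. Put $\mathrm{Aut}_S(P)=\{c_s|_P:s\in N_S(P)\}$, $\mathrm{Aut}_S(P;X)=\{(c_s|_P,\ell_s):s\in N_S(P)\}$, $\Sigma_{\mathfrak{X}}(P)=\{\sigma:\exists\varphi,(\varphi,\sigma)\in\mathfrak{X}(P)\}$, $\Sigma^S_{\mathfrak{X}}(P)=\{\ell_s:s\in N_S(P)\}$, $\mathcal{F}^{\mathfrak{X}}(P)_0=\{\varphi:(\varphi,\mathrm{id}_X)\in\mathfrak{X}(P)\}$, $\mathcal{F}_S(P)_0=\{c_s|_P:s\in N_S(P;X)\}$, $\Sigma_{\mathfrak{X}}(P)_0=\{\sigma:(\mathrm{id}_P,\sigma)\in\mathfrak{X}(P)\}$, $\Sigma^S_{\mathfrak{X}}(P)_0=\{\ell_s:s\in Z_S(P)\}$. The extender of $(\varphi,\sigma)\in\mathfrak{X}(P,Q)_{\mathrm{iso}}$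 is $N_{(\varphi,\sigma)}=\{n\in N_S(P):(\varphi c_n\varphi^{-1},\sigma\ell_n\sigma^{-1})\in\mathrm{Aut}_S(Q;X)\}$. $\mathfrak{X}$ is saturated if: (1) for every $P\le S$, fully normalized implies fully $X$-normalized and fully centralized, and each of fully $X$-normalized and fully centralized implies fully $X$-centralized; (2) if $P$ is fully normalized then $\mathrm{Aut}_S(P)\in\mathrm{Syl}_p(\mathcal{F}^{\mathfrak{X}}(P))$, $\mathrm{Aut}_S(P;X)\in\mathrm{Syl}_p(\mathfrak{X}(P))$ and $\Sigma^S_{\mathfrak{X}}(P)\in\mathrm{Syl}_p(\Sigma_{\mathfrak{X}}(P))$; (3) if $P$ is fully $X$-normalized then $\mathcal{F}_S(P)_0\in\mathrm{Syl}_p(\mathcal{F}^{\mathfrak{X}}(P)_0)$; (4) if $P$ is fully centralized then $\Sigma^S_{\mathfrak{X}}(P)_0\in\mathrm{Syl}_p(\Sigma_{\mathfrak{X}}(P)_0)$; (5) if $Q$ is fully $X$-centralized and $(\varphi,\sigma)\in\mathfrak{X}(P,Q)_{\mathrm{iso}}$, there is $(\widetilde\varphi,\sigma)\in\mathfrak{X}(N_{(\varphi,\sigma)},S)$ with $\widetilde\varphi|_P=\varphi$. $\mathfrak{X}$ is transitive if $\mathfrak{X}(1)$ acts transitively on $X$. For transitive $\mathfrak{X}$: $S_x$ denotes the stabilizer of $x$ in $S$; $x\in X$ is fully stabilized if $|S_x|\ge|S_y|$ for all $y\in X$; the stabilizer fusion action system $\mathfrak{X}_x$ is the fusion action system of $S_x$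 on $X$ (with the restricted action) with $\mathfrak{X}_x(P,Q)=\{(\varphi,\sigma)\in\mathfrak{X}(P,Q):\sigma(x)=x\}$ for $P,Q\le S_x$. *)

(* Defs.v *)
From mathcomp Require Import all_boot all_fingroup all_solvable.

Set Implicit Arguments.
Unset Strict Implicit.
Unset Printing Implicit Defensive.

Local Open Scope group_scope.

(* Only the values of lact at elements of S are meaningful. *)
Record left_action (gT : finGroupType) (S : {group gT}) (X : finType) :=
  LeftAction {
    lact :> gT -> X -> X;
    lact1 : forall x, lact 1 x = x;
    lactM : {in S &, forall s t x, lact (s * t) x = lact s (lact t x)}
  }.

(* A homomorphism P -> Q is a finite function on the ambient type that takes
   the value 1 off P, so that Leibniz equality is equality of functions on P,
   and composition of homomorphisms is composition of functions.
   {perm _} multiplies from left to right: (s * t) x = t (s x). Thus the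
   composite of sigma after tau is tau * sigma, and
   sigma ell sigma^-1 is ell ^ sigma. *)
Section Maps.

Variable gT : finGroupType.
Implicit Types (P Q : {group gT}) (f : gT -> gT) (phi psi : {ffun gT -> gT}).

Definition restr P f : {ffun gT -> gT} := [ffun g => if g \in P then f g else 1].

Definition hid P := restr P id.

Definition hcomp psi phi : {ffun gT -> gT} := [ffun g => psi (phi g)].

(* The inverse of phi : P -> phi(P), for phi injective on P. *)
Definition hinv P phi : {ffun gT -> gT} :=
  [ffun h => odflt 1 [pick g in P | phi g == h]].

Definition cmap P (s : gT) := restr P (fun h => s * h * s^-1).

Definition Inj P Q : {set {ffun gT -> gT}} :=
  [set phi | [&& phi \in pffun_on 1 P Q, morphic P phi & dinjectiveb phi P]].

(* A set T of endomaps of P, seen inside the group Aut P of permutations of the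
   ambient type. The group law is opposite to composition, which affects
   neither subgroups nor orders. *)
Definition autset P (T : {set {ffun gT -> gT}}) : {set {perm gT}} :=
  [set a in Aut P | restr P a \in T].

Definition autset2 (X : finType) P (T : {set {ffun gT -> gT} * {perm X}}) :
    {set {perm gT} * {perm X}} :=
  [set u | (u.1 \in Aut P) && ((restr P u.1, u.2) \in T)].

End Maps.

Section FusionActionSystem.

Variables (gT : finGroupType) (X : finType).

Local Notation mor := ({ffun gT -> gT} * {perm X})%type.

Implicit Types (P Q R : {group gT}) (u v w : mor).

Definition ucomp v u : mor := (hcomp v.1 u.1, u.2 * v.2).
Definition uid P : mor := (hid P, 1).
Definition uinv P u : mor := (hinv P u.1, u.2^-1).

(* Also the inclusion (incl, id_X) of R in any larger subgroup. *)
Definition uincl R : mor := (hid R, 1).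

Section Action.

Variables (S : {group gT}) (a : left_action S X).

Definition lact_in (s : gT) (x : X) := if s \in S then a s x else x.

Lemma lact_in_inj s : injective (lact_in s).
Proof.
move=> x y; rewrite /lact_in; case: ifP => // Ss eq_xy.
rewrite -(lact1 a x) -(lact1 a y) -(mulVg s).
by rewrite !lactM ?groupV // eq_xy.
Qed.

Definition ell (s : gT) : {perm X} := perm (@lact_in_inj s).

Lemma ellE s x : s \in S -> ell s x = a s x.
Proof. by move=> Ss; rewrite permE /lact_in Ss. Qed.

Definition intertwined P (phi : {ffun gT -> gT}) (sigma : {perm X}) :=
  [forall g in P, ell g ^ sigma == ell (phi g)].

Definition Uhom P Q : {set mor} :=
  [set u | (u.1 \in Inj P Q) && intertwined P u.1 u.2].

Definition SXmor P s : mor := (cmap P s, ell s).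

Definition SXhom P Q : {set mor} :=
  [set SXmor P s | s in S & (P :^ s^-1 \subset Q)].

End Action.

Definition iso_of (hom : {group gT} -> {group gT} -> {set mor}) P Q : {set mor} :=
  [set u in hom P Q |
    [exists v in hom Q P, (ucomp v u == uid P) && (ucomp u v == uid Q)]].

(* Only the values of fas_hom at subgroups of S are meaningful. Identities
   belong to the system by fas_S, with s = 1. *)
Record fusion_action_system (S : {group gT}) (a : left_action S X) :=
  FusionActionSystem {
    fas_hom :> {group gT} -> {group gT} -> {set mor};
    fas_U : forall P Q, P \subset S -> Q \subset S ->
      fas_hom P Q \subset Uhom a P Q;
    fas_S : forall P Q, P \subset S -> Q \subset S ->
      SXhom a P Q \subset fas_hom P Q;
    fas_comp : forall P Q R u v, P \subset S -> Q \subset S -> R \subset S ->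
      u \in fas_hom P Q -> v \in fas_hom Q R -> ucomp v u \in fas_hom P R;
    fas_factor : forall P Q u, P \subset S -> Q \subset S ->
      u \in fas_hom P Q ->
      exists R : {group gT}, R \subset Q /\
        (exists2 v, v \in iso_of fas_hom P R & u = ucomp (uincl R) v)
  }.

Section Saturation.

Variables (S : {group gT}) (a : left_action S X).
Variable XX : fusion_action_system a.

Definition fas_iso P Q := iso_of XX P Q.

Definition Fhom P Q : {set {ffun gT -> gT}} := [set u.1 | u in XX P Q].

Definition Fconj P Q : Prop :=
  exists phi psi, [/\ phi \in Fhom P Q, psi \in Fhom Q P,
    hcomp psi phi = hid P & hcomp phi psi = hid Q].

Definition action_ker : {set gT} := [set s in S | ell a s == 1].

Definition normX P : {set gT} := 'N_S(P) :&: action_ker.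
Definition centX P : {set gT} := 'C_S(P) :&: action_ker.

Definition fully (m : {group gT} -> nat) P : Prop :=
  forall Q, Q \subset S -> Fconj P Q -> m Q <= m P.

Definition fully_normalized := fully (fun Q => #|'N_S(Q)|).
Definition fully_centralized := fully (fun Q => #|'C_S(Q)|).
Definition fully_Xnormalized := fully (fun Q => #|normX Q|).
Definition fully_Xcentralized := fully (fun Q => #|centX Q|).

Definition AutS P : {set {ffun gT -> gT}} := [set cmap P s | s in 'N_S(P)].
Definition AutSX P : {set mor} := [set SXmor a P s | s in 'N_S(P)].
Definition SigmaX P : {set {perm X}} := [set u.2 | u in XX P P].
Definition SigmaS P : {set {perm X}} := [set ell a s | s in 'N_S(P)].
Definition F0 P : {set {ffun gT -> gT}} := [set phi | (phi, 1) \in XX P P].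
Definition FS0 P : {set {ffun gT -> gT}} := [set cmap P s | s in normX P].
Definition SigmaX0 P : {set {perm X}} := [set sigma | (hid P, sigma) \in XX P P].
Definition SigmaS0 P : {set {perm X}} := [set ell a s | s in 'C_S(P)].

Definition extender P Q u : {set gT} :=
  [set n in 'N_S(P) | ucomp u (ucomp (SXmor a P n) (uinv P u)) \in AutSX Q].

(* Z_S(P) is the centralizer 'C_S(P). The extender is a subgroup (extender_group_set below), so
   << >> only supplies the group structure. *)
Definition saturated (p : nat) : Prop :=
  [/\ forall P, P \subset S ->
        [/\ fully_normalized P -> fully_Xnormalized P /\ fully_centralized P,
            fully_Xnormalized P -> fully_Xcentralized P
          & fully_centralized P -> fully_Xcentralized P],
      forall P, P \subset S -> fully_normalized P ->
        [/\ p.-Sylow(autset P (Fhom P P)) (autset P (AutS P)),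
            p.-Sylow(autset2 P (XX P P)) (autset2 P (AutSX P))
          & p.-Sylow(SigmaX P) (SigmaS P)],
      forall P, P \subset S -> fully_Xnormalized P ->
        p.-Sylow(autset P (F0 P)) (autset P (FS0 P)),
      forall P, P \subset S -> fully_centralized P ->
        p.-Sylow(SigmaX0 P) (SigmaS0 P)
    & forall P Q u, P \subset S -> Q \subset S -> fully_Xcentralized Q ->
        u \in fas_iso P Q ->
        exists2 phi : {ffun gT -> gT},
          (phi, u.2) \in XX <<extender P Q u>>%G S & {in P, phi =1 u.1}].

Definition fas_transitive : bool :=
  [transitive SigmaX 1%G, on [set: X] | 'P].

End Saturation.

Section Stabilizer.

Variables (S : {group gT}) (a : left_action S X) (x : X).

Definition stab : {set gT} := [set s in S | a s x == x].

Lemma stab_group_set : group_set stab.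
Proof.
apply/group_setP; split=> [|s t]; first by rewrite inE group1 lact1 eqxx.
rewrite !inE => /andP[Ss /eqP sx] /andP[St /eqP tx].
by rewrite groupM // lactM // tx sx eqxx.
Qed.

Canonical stab_group := Group stab_group_set.

Lemma stab_sub : stab_group \subset S.
Proof. by apply/subsetP=> s; rewrite inE => /andP[]. Qed.

Lemma stab_lactM :
  {in stab_group &, forall s t y, a (s * t) y = a s (a t y)}.
Proof. by move=> s t /(subsetP stab_sub) Ss /(subsetP stab_sub) St y; apply: lactM. Qed.

Definition stab_action : left_action stab_group X :=
  LeftAction (lact1 a) stab_lactM.

Lemma stab_ell s : s \in stab_group -> ell stab_action s = ell a s.
Proof.
by move=> Ts; apply/permP=> y; rewrite !ellE // (subsetP stab_sub).
Qed.

Variable XX : fusion_action_system a.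

Definition stab_hom P Q : {set mor} := [set u in XX P Q | u.2 x == x].

Let subTS P : P \subset stab_group -> P \subset S.
Proof. by move/subset_trans; apply; apply: stab_sub. Qed.

Lemma stab_fas_U P Q : P \subset stab_group -> Q \subset stab_group ->
  stab_hom P Q \subset Uhom stab_action P Q.
Proof.
move=> PT QT; apply/subsetP=> u; rewrite inE => /andP[Xu _].
have := subsetP (fas_U XX (subTS PT) (subTS QT)) u Xu; rewrite !inE.
case/andP=> phiI /forall_inP tw; rewrite phiI; apply/forall_inP=> g Pg.
case/and3P: phiI => /pffun_onP[_ imQ] _ _.
have Qg: u.1 g \in Q by apply: imQ; apply: image_f.
by rewrite !stab_ell ?tw //; [apply: subsetP Qg | apply: subsetP Pg].
Qed.

Lemma stab_fas_S P Q : P \subset stab_group -> Q \subset stab_group ->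
  SXhom stab_action P Q \subset stab_hom P Q.
Proof.
move=> PT QT; apply/subsetP=> _ /imsetP[s /[!inE] /andP[/andP[Ss sx] PQ] ->].
rewrite /SXmor stab_ell ?inE ?Ss //= ellE // sx andbT.
apply: (subsetP (fas_S XX (subTS PT) (subTS QT))).
by apply/imsetP; exists s; rewrite // inE Ss.
Qed.

Lemma stab_fas_comp P Q R u v :
  P \subset stab_group -> Q \subset stab_group -> R \subset stab_group ->
  u \in stab_hom P Q -> v \in stab_hom Q R -> ucomp v u \in stab_hom P R.
Proof.
move=> PT QT RT; rewrite !inE => /andP[Xu /eqP ux] /andP[Xv /eqP vx].
by rewrite /= permM ux vx eqxx andbT; apply: fas_comp Xu Xv; apply: subTS.
Qed.

Lemma stab_fas_factor P Q u : P \subset stab_group -> Q \subset stab_group ->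
  u \in stab_hom P Q ->
  exists R : {group gT}, R \subset Q /\
    (exists2 v, v \in iso_of stab_hom P R & u = ucomp (uincl R) v).
Proof.
move=> PT QT; rewrite inE => /andP[Xu /eqP ux].
have [R [RQ [v isov def_u]]] := fas_factor (subTS PT) (subTS QT) Xu.
exists R; split=> //; exists v => //.
have vx : v.2 x = x by rewrite -[RHS]ux def_u /= mulg1.
move: isov; rewrite !inE => /andP[-> /exists_inP[w Xw /andP[wv vw]]].
rewrite vx eqxx /=; apply/exists_inP; exists w; last by rewrite wv.
have /(congr1 (fun t : mor => t.2 x)) := eqP wv.
by rewrite /= permM vx perm1 inE Xw => /eqP.
Qed.

Definition stab_system : fusion_action_system stab_action :=
  FusionActionSystem stab_fas_U stab_fas_S stab_fas_comp stab_fas_factor.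

End Stabilizer.

Definition fully_stabilized (S : {group gT}) (a : left_action S X) (x : X) : Prop :=
  forall y : X, #|stab a y| <= #|stab a x|.

(* The sets in the definition of saturation are subgroups. *)
Section Subgroups.

Variables (S : {group gT}) (a : left_action S X) (XX : fusion_action_system a).

Lemma ell1 : ell a 1 = 1.
Proof. by apply/permP=> y; rewrite ellE // lact1 perm1. Qed.

Lemma ellM : {in S &, forall s t, ell a (s * t) = ell a t * ell a s}.
Proof.
by move=> s t Ss St; apply/permP=> y; rewrite permM !ellE ?groupM // lactM.
Qed.

Lemma hcompA (f g h : {ffun gT -> gT}) :
  hcomp f (hcomp g h) = hcomp (hcomp f g) h.
Proof. by apply/ffunP=> y; rewrite !ffunE. Qed.

Lemma ucompA u v w : ucomp u (ucomp v w) = ucomp (ucomp u v) w.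
Proof. by rewrite /ucomp hcompA mulgA. Qed.

Lemma SXmor1 P : SXmor a P 1 = uid P.
Proof.
rewrite /SXmor /uid ell1; congr (_, _).
by apply/ffunP=> g; rewrite !ffunE invg1 mulg1 mul1g.
Qed.

Lemma SXmorM P : {in 'N_S(P) &, forall s t,
  SXmor a P (s * t) = ucomp (SXmor a P s) (SXmor a P t)}.
Proof.
move=> s t /setIP[Ss _] /setIP[St NPt]; rewrite /SXmor /ucomp ellM //=.
congr (_, _); apply/ffunP=> g; rewrite !ffunE; case: ifP => [Pg|_]; last first.
  by rewrite !mulg1 mulgV if_same.
have -> : t * g * t^-1 = g ^ t^-1 by rewrite conjgE invgK mulgA.
by rewrite memJ_norm ?groupV // Pg conjgE invgK invMg !mulgA.
Qed.

Lemma SXmorP P s : P \subset S -> s \in 'N_S(P) -> SXmor a P s \in XX P P.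
Proof.
move=> PS /setIP[Ss NPs]; apply: (subsetP (fas_S XX PS PS)).
apply/imsetP; exists s => //; rewrite inE Ss.
by rewrite (normP _) ?groupV //=.
Qed.

Lemma fas_id P : P \subset S -> uid P \in XX P P.
Proof. by move=> PS; rewrite -SXmor1 SXmorP. Qed.

Lemma restr1 P : restr P (1 : {perm gT}) = hid P.
Proof. by apply/ffunP=> g; rewrite !ffunE perm1. Qed.

Lemma restrM P (b c : {perm gT}) : b \in Aut P -> c \in Aut P ->
  restr P (b * c) = hcomp (restr P c) (restr P b).
Proof.
move=> Ab Ac; apply/ffunP=> g; rewrite !ffunE permM.
case: ifP => [Pg|_]; first by rewrite Aut_closed.
by rewrite group1 -(autmE Ac) morph1.
Qed.

Lemma autset2_group P (T : {set mor}) :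
    uid P \in T -> {in T &, forall u v, ucomp v u \in T} ->
  group_set (autset2 P T).
Proof.
move=> T1 TM; apply/group_setP; split=> [|b c].
  by rewrite inE group1 restr1.
rewrite [b \in _]inE [c \in _]inE [b * c \in _]inE.
move=> /andP[Ab Tb] /andP[Ac Tc] /=.
by rewrite groupM // restrM //; apply: TM Tb Tc.
Qed.

Lemma autset_group P (T : {set {ffun gT -> gT}}) :
    hid P \in T -> {in T &, forall phi psi, hcomp psi phi \in T} ->
  group_set (autset P T).
Proof.
move=> T1 TM; apply/group_setP; split=> [|b c].
  by rewrite inE group1 restr1.
rewrite [b \in _]inE [c \in _]inE [b * c \in _]inE.
move=> /andP[Ab Tb] /andP[Ac Tc].
by rewrite groupM // restrM //; apply: TM.
Qed.

Section AtP.

Variable P : {group gT}.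
Hypothesis PS : P \subset S.

Lemma XX_comp u v : u \in XX P P -> v \in XX P P -> ucomp v u \in XX P P.
Proof. exact: fas_comp. Qed.

Lemma XX_group_set : group_set (autset2 P (XX P P)).
Proof. by apply: autset2_group; [apply: fas_id | apply: XX_comp]. Qed.

Lemma Fhom_group_set : group_set (autset P (Fhom XX P P)).
Proof.
apply: autset_group => [|_ _ /imsetP[u Xu ->] /imsetP[v Xv ->]].
  by apply/imsetP; exists (uid P); rewrite ?fas_id.
by apply/imsetP; exists (ucomp v u); rewrite ?XX_comp.
Qed.

Lemma F0_group_set : group_set (autset P (F0 XX P)).
Proof.
apply: autset_group => [|phi psi]; first by rewrite inE fas_id.
by rewrite !inE => Xphi Xpsi; have:= XX_comp Xphi Xpsi; rewrite /ucomp mulg1.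
Qed.

Lemma SigmaX_group_set : group_set (SigmaX XX P).
Proof.
apply/group_setP; split=> [|_ _ /imsetP[u Xu ->] /imsetP[v Xv ->]].
  by apply/imsetP; exists (uid P); rewrite ?fas_id.
by apply/imsetP; exists (ucomp v u); rewrite ?XX_comp.
Qed.

Lemma hcomp1 : hcomp (hid P) (hid P) = hid P.
Proof. by apply/ffunP=> g; rewrite !ffunE; case: (boolP (g \in P)) => [-> | _]; rewrite ?if_same. Qed.

Lemma SigmaX0_group_set : group_set (SigmaX0 XX P).
Proof.
apply/group_setP; split=> [|s t]; first by rewrite inE fas_id.
by rewrite !inE => Xs Xt; have:= XX_comp Xs Xt; rewrite /ucomp hcomp1.
Qed.

Lemma AutSX_comp : {in AutSX a P &, forall u v, ucomp v u \in AutSX a P}.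
Proof.
move=> _ _ /imsetP[s Ns ->] /imsetP[t Nt ->].
by apply/imsetP; exists (t * s); rewrite ?groupM ?SXmorM.
Qed.

Lemma AutSX_group_set : group_set (autset2 P (AutSX a P)).
Proof.
apply: autset2_group; last exact: AutSX_comp.
by apply/imsetP; exists 1; rewrite ?group1 ?SXmor1.
Qed.

Lemma cmap1 : cmap P 1 = hid P.
Proof. by have /(congr1 fst) := SXmor1 P. Qed.

Lemma cmapM : {in 'N_S(P) &, forall s t,
  cmap P (s * t) = hcomp (cmap P s) (cmap P t)}.
Proof. by move=> s t Ns Nt; have /(congr1 fst) := SXmorM Ns Nt. Qed.

Lemma AutS_group_set : group_set (autset P (AutS S P)).
Proof.
apply: autset_group => [|_ _ /imsetP[s Ns ->] /imsetP[t Nt ->]].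
  by apply/imsetP; exists 1; rewrite ?group1 ?cmap1.
by apply/imsetP; exists (t * s); rewrite ?groupM ?cmapM.
Qed.

Lemma FS0_group_set : group_set (autset P (FS0 a P)).
Proof.
apply: autset_group => [|_ _ /imsetP[s Ns ->] /imsetP[t Nt ->]].
  apply/imsetP; exists 1; rewrite ?cmap1 // in_setI group1 inE group1.
  by rewrite ell1 /=.
move: Ns Nt => /setIP[Ns /setIdP[Ss /eqP ks]] /setIP[Nt /setIdP[St /eqP kt]].
apply/imsetP; exists (t * s); last by rewrite cmapM.
by rewrite in_setI groupM // inE groupM //= ellM // ks kt mulg1.
Qed.

Lemma SigmaS_group_set : group_set (SigmaS a P).
Proof.
apply/group_setP; split=> [|_ _ /imsetP[s Ns ->] /imsetP[t Nt ->]].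
  by apply/imsetP; exists 1; rewrite ?group1 ?ell1.
apply/imsetP; exists (t * s); first by rewrite groupM.
by rewrite ellM //; [move: Nt | move: Ns] => /setIP[].
Qed.

Lemma SigmaS0_group_set : group_set (SigmaS0 a P).
Proof.
apply/group_setP; split=> [|_ _ /imsetP[s Ns ->] /imsetP[t Nt ->]].
  by apply/imsetP; exists 1; rewrite ?group1 ?ell1.
apply/imsetP; exists (t * s); first by rewrite groupM.
by rewrite ellM //; [move: Nt | move: Ns] => /setIP[].
Qed.

End AtP.

Lemma ucomp_idl P Q u : P \subset S -> Q \subset S ->
  u \in XX P Q -> ucomp (uid Q) u = u.
Proof.
move=> PS QS Xu; have := subsetP (fas_U XX PS QS) u Xu.
rewrite !inE => /andP[/and3P[/pffun_onP[/subsetP supu imu] _ _] _].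
rewrite /ucomp mulg1; case: u {Xu} supu imu => phi sigma /= supu imu.
congr (_, _); apply/ffunP=> g; rewrite !ffunE; case: ifP => // /negP[].
have [Pg | nPg] := boolP (g \in P); first by apply: imu; apply: image_f.
have /eqP-> := contraNT (supu g) nPg; exact: group1.
Qed.

Lemma uinvE P Q u v : P \subset S -> Q \subset S ->
    u \in XX P Q -> v \in XX Q P -> ucomp v u = uid P -> ucomp u v = uid Q ->
  uinv P u = v.
Proof.
move=> PS QS Xu Xv vu uv.
have := subsetP (fas_U XX PS QS) u Xu; rewrite !inE.
case/andP=> /and3P[/pffun_onP[_ imu] _ _] _.
have := subsetP (fas_U XX QS PS) v Xv; rewrite !inE.
case/andP=> /and3P[/pffun_onP[/subsetP supv imv] _ _] _.
case: u v vu uv imu supv imv {Xu Xv} => [f s] [g t] [vu1 vu2] [uv1 uv2] /=.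
move=> imu supv imv; congr (_, _); last by apply/eqP; rewrite eq_invg_mul vu2.
apply/ffunP=> h; rewrite ffunE.
have gf k : k \in P -> g (f k) = k.
  by move=> Pk; have /ffunP/(_ k) := vu1; rewrite !ffunE Pk.
have fg k : k \in Q -> f (g k) = k.
  by move=> Qk; have /ffunP/(_ k) := uv1; rewrite !ffunE Qk.
case: pickP => [k /andP[Pk /eqP <-] | none] /=; first by rewrite gf.
have [Qh | nQh] := boolP (h \in Q); last first.
  by have /eqP-> := contraNT (supv h) nQh.
by have := none (g h); rewrite fg // eqxx andbT imv // image_f.
Qed.

Lemma extender_group_set P Q u : P \subset S -> Q \subset S ->
  u \in fas_iso XX P Q -> group_set (extender a P Q u).
Proof.
move=> PS QS; rewrite inE => /andP[Xu /exists_inP[v Xv /andP[/eqP vu /eqP uv]]].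
rewrite /extender (uinvE PS QS Xu Xv vu uv); apply/group_setP; split=> [|n m].
  rewrite inE group1 SXmor1 (ucomp_idl QS PS Xv) uv -(SXmor1 Q).
  by apply/imsetP; exists 1; rewrite ?group1.
case/setIdP=> Nn An /setIdP[Nm Am].
apply/setIdP; rewrite groupM //; split=> //.
suff -> : ucomp u (ucomp (SXmor a P (n * m)) v) =
    ucomp (ucomp u (ucomp (SXmor a P n) v)) (ucomp u (ucomp (SXmor a P m) v)).
  exact: AutSX_comp.
rewrite SXmorM //.
rewrite -!ucompA; congr (ucomp u (ucomp _ _)); rewrite !ucompA vu.
by rewrite (ucomp_idl PS PS) ?SXmorP.
Qed.

End Subgroups.

End FusionActionSystem.

(* Main.v *)
Require Import Defs.
From mathcomp Require Import all_boot all_fingroup all_solvable.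

(** The group W of pairs (permutation of the ambient group, permutation of X)
    contains all the automizers X(P) at once, and every morphism of a fusion
    action system with source P is the restriction to P of an element of W.
    Composition becomes the product of W, transport along an isomorphism
    P -> Q becomes conjugation, X(P) :^ g = X(Q), and Sylow's theorems apply
    inside W.

    A criterion for saturation (saturated_criterion).  Let the extension axiom
    hold, and let each class of conjugate subgroups contain a fully
    X-centralized P0 such that Aut_S(P0; X) is a Sylow p-subgroup of X(P0).
    For P conjugate to P0, Sylow's theorem in X(P0) provides an isomorphism
    P -> P0 that carries Aut_S(P; X) into Aut_S(P0; X); its extender is all of
    N_S(P), so it extends to a morphism h on N_S(P) (Xiso_receptive).
    The groups N_S(P), N_S(P; X), Z_S(P) and Z_S(P; X) all have the form
    {n in N_S(P) | (c_n, ell_n) in L}, where L is one of the four products of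
    trivial or full factors of W.  As L is normal in W, h embeds the group
    attached to L and P into the one attached to L and P0.  Hence P0 is fully
    normalized, centralized, X-normalized and X-centralized; and if P is
    extremal for L, then h is onto, which gives both the implications between
    the four conditions (fully_subset) and the Sylow axioms, by intersecting
    X(P0) and its Sylow subgroup with L (fully_Sylow).

    The stabilizer system.  The group ell(S) is a Sylow p-subgroup of X(1),
    and x is fully stabilized, so ell(S_x) is a Sylow p-subgroup of the
    stabilizer of x in X(1) (Sylow_stab).  As X(1) is transitive, for each y in
    X some element of X(1) takes y to x and conjugates ell(S_y) into ell(S_x),
    and the extension axiom at the trivial subgroup lifts it to a morphism k
    from S_y to S_x (stab_to_x).  For P in S_x take g : P -> P1 with P1 fully normalized
    in the large system.  After correcting g by an element of X(P1),
    Aut_S(P1; X) meets X_x(P) :^ g, the stabilizer of y = g(x) in X(P1), in a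
    Sylow p-subgroup.  Since P1 lies in S_y, the subgroup k(P1) of S_x is
    conjugate to P by k g, which fixes x, and k moves that Sylow subgroup into
    Aut_{S_x}(k(P1); X).  So k(P1) is a representative as required by the
    criterion (stab_representative), and it is fully X-centralized even in the
    large system.  Therefore full X-centralization means the same in both
    systems, and the extension axiom restricts (stab_extension). *)

Set Implicit Arguments.
Unset Strict Implicit.
Unset Printing Implicit Defensive.

Local Open Scope group_scope.

(** * Permutations and Sylow subgroups *)

(** The symmetric group is #|A|-transitive. *)
Lemma perm_extension (T : finType) (A : {set T}) (f : T -> T) :
  {in A &, injective f} -> exists b : {perm T}, {in A, b =1 f}.
Proof.
move=> injf; have trS := ntransitive_weak (max_card A) (Sym_trans T).
have dA : [tuple of enum A] \in (#|A|).-dtuple([set: T]).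
  by rewrite inE enum_uniq; apply/subsetP=> y; rewrite inE.
have dfA : [tuple of map f (enum A)] \in (#|A|).-dtuple([set: T]).
  rewrite inE map_inj_in_uniq ?enum_uniq => [|y z]; last first.
    by rewrite !mem_enum; apply: injf.
  by apply/subsetP=> y; rewrite inE.
have [b _ /(congr1 val) /= /eq_in_map fb] := atransP2 trS dA dfA.
by exists b => y Ay; rewrite fb ?mem_enum //=.
Qed.

(** A Sylow p-subgroup of K has a G-conjugate inside H, and H :&: K :^ c is a
    p-group that contains this conjugate. *)
Lemma Sylow_setI_conj (gT : finGroupType) p (G H K : {group gT}) :
    p.-Sylow(G) H -> K \subset G ->
  exists2 c, c \in G & p.-Sylow(K :^ c) (H :&: K :^ c).
Proof.
move=> sylH KG; have [R sylR] := Sylow_exists p K.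
have [RK pR _] := and3P sylR.
have [c Gc RcH] := Sylow_Jsub sylH (subset_trans RK KG) pR; exists c => //.
have sylRc : p.-Sylow(K :^ c) (R :^ c) by rewrite pHallJ2.
rewrite (sub_pHall sylRc (pgroupS (subsetIl H (K :^ c)) (pHall_pgroup sylH))) //.
  by rewrite subsetI RcH conjSg.
exact: subsetIr.
Qed.

Lemma Sylow_imset (aT rT : finGroupType) (f : aT -> rT) p (G H : {set aT}) :
    {morph f : y z / y * z} -> group_set G -> group_set H ->
  p.-Sylow(G) H -> p.-Sylow(f @: G) (f @: H).
Proof.
move=> fM gG gH; pose fm := Morphism (D := [set: aT]) (in2W fM).
move/(@morphim_pHall _ _ _ fm p (Group gG) (Group gH) (subsetT _)).
by rewrite !morphimEsub ?subsetT.
Qed.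

(** * Morphisms as elements of a group of pairs *)

Section Realization.

Variables (gT : finGroupType) (X : finType).

Local Notation mor := ({ffun gT -> gT} * {perm X})%type.
Local Notation W := ({perm gT} * {perm X})%type.

Implicit Types (P Q R N : {group gT}) (g h b : W).

(** The morphism with source P represented by g.  Its target is not recorded,
    as inclusions do not change the underlying function. *)
Definition realize P g : mor := (restr P g.1, g.2).

Lemma realize1 P : realize P 1 = uid X P.
Proof. by rewrite /realize restr1. Qed.

Lemma eq_realize P g h :
  {in P, g.1 =1 h.1} -> g.2 = h.2 -> realize P g = realize P h.
Proof.
move=> gh1 gh2; rewrite /realize gh2; congr (_, _); apply/ffunP=> y.
by rewrite !ffunE; case: ifP => // /gh1.
Qed.

Lemma realize_eqP P g h :
  realize P g = realize P h -> {in P, g.1 =1 h.1} /\ g.2 = h.2.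
Proof.
case=> /ffunP gh1 ->; split=> // y Py.
by have:= gh1 y; rewrite !ffunE Py.
Qed.

Lemma perm_morph1 N (f : {perm gT}) :
  {in N &, {morph f : y z / y * z}} -> f 1 = 1.
Proof.
by move=> fM; apply: (mulgI (f 1)); rewrite -fM ?group1 // !mulg1.
Qed.

Lemma perm_morphV N (f : {perm gT}) :
  {in N &, {morph f : y z / y * z}} -> {in N, {morph f : y / y^-1}}.
Proof.
move=> fM y Ny; apply: (mulgI (f y)).
by rewrite -fM ?groupV // !mulgV (perm_morph1 fM).
Qed.

Lemma perm_morphJ N (f : {perm gT}) :
  {in N &, {morph f : y z / y * z}} -> {in N &, {morph f : y z / y ^ z}}.
Proof.
move=> fM y z Ny Nz; rewrite /= !conjgE !fM ?groupM ?groupV //.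
by rewrite (perm_morphV fM).
Qed.

Lemma perm_morph_group_set N (f : {perm gT}) :
  {in N &, {morph f : y z / y * z}} -> group_set (f @: N).
Proof.
move=> fM; apply/group_setP; split=> [|_ _ /imsetP[y Ny ->] /imsetP[z Nz ->]].
  by rewrite -(perm_morph1 fM) imset_f.
by rewrite -fM // imset_f ?groupM.
Qed.

Lemma realize_comp P Q g h :
    {in P, forall y, g.1 y \in Q} -> {in Q &, {morph h.1 : y z / y * z}} ->
  ucomp (realize Q h) (realize P g) = realize P (g * h).
Proof.
move=> gPQ hM; congr (_, _); apply/ffunP=> y; rewrite !ffunE permM.
have [Py | _] := boolP (y \in P); first by rewrite (gPQ y Py).
by rewrite group1 (perm_morph1 hM).
Qed.

Lemma realize_uinv P g : g.1 1 = 1 -> forall Q : {group gT}, g.1 @: P = Q ->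
  uinv P (realize P g) = realize Q g^-1.
Proof.
move=> g1 Q PQ; congr (_, _); apply/ffunP=> y; rewrite !ffunE -PQ.
case: pickP => [z /andP[Pz] | none] /=.
  by rewrite ffunE Pz => /eqP <-; rewrite imset_f // permK.
case: imsetP => // -[z Pz def_y]; have := none z.
by rewrite ffunE Pz def_y eqxx.
Qed.

Section System.

Variables (S : {group gT}) (a : left_action S X).
Variable XX : fusion_action_system a.

Lemma realizeP P Q u : P \subset S -> Q \subset S -> u \in XX P Q ->
  exists g, u = realize P g.
Proof.
move=> PS QS /(subsetP (fas_U XX PS QS)); rewrite !inE => /andP[/and3P[]].
move=> /pffun_onP[/subsetP supu _] _ /dinjectiveP/perm_extension[f fu] _.
exists (f, u.2); case: u supu fu => u1 u2 /= supu fu; congr (_, _).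
apply/ffunP=> y; rewrite ffunE; case: ifP => [/fu-> // | nPy].
by apply/eqP/(contraFT _ nPy); apply: supu.
Qed.

Lemma realize_hom P Q g : P \subset S -> Q \subset S -> realize P g \in XX P Q ->
  [/\ {in P &, {morph g.1 : y z / y * z}}, {in P, forall y, g.1 y \in Q}
    & {in P, forall y, ell a y ^ g.2 = ell a (g.1 y)}].
Proof.
move=> PS QS /(subsetP (fas_U XX PS QS)); rewrite !inE => /andP[/and3P[]].
move=> /pffun_onP[_ imu] /morphicP uM _ /forall_inP tw.
have gE y : y \in P -> (realize P g).1 y = g.1 y by move=> Py; rewrite ffunE Py.
split=> [y z Py Pz | y Py | y Py].
- by have:= uM y z Py Pz; rewrite /= !gE ?groupM.
- by rewrite -gE //; apply: imu; apply: image_f.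
by rewrite (eqP (tw y Py)) gE.
Qed.

Lemma realize_comp_mem P Q R g h : P \subset S -> Q \subset S -> R \subset S ->
    realize P g \in XX P Q -> realize Q h \in XX Q R ->
  realize P (g * h) \in XX P R.
Proof.
move=> PS QS RS Xg Xh; have [_ gPQ _] := realize_hom PS QS Xg.
have [hM _ _] := realize_hom QS RS Xh; rewrite -(realize_comp gPQ hM).
exact: fas_comp Xg Xh.
Qed.

Lemma realize_incl P Q : P \subset Q -> Q \subset S -> realize P 1 \in XX P Q.
Proof.
move=> PQ QS; have PS := subset_trans PQ QS.
rewrite realize1 -(SXmor1 a); apply: (subsetP (fas_S XX PS QS)).
by apply/imsetP; exists 1; rewrite // inE group1 invg1 conjsg1.
Qed.

Lemma realize_sub P Q P' Q' g : P' \subset P -> Q \subset Q' ->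
    P \subset S -> Q' \subset S ->
  realize P g \in XX P Q -> realize P' g \in XX P' Q'.
Proof.
move=> P'P QQ' PS Q'S Xg.
have P'S := subset_trans P'P PS; have QS := subset_trans QQ' Q'S.
have Xg' := realize_comp_mem P'S PS QS (realize_incl P'P PS) Xg.
have := realize_comp_mem P'S QS Q'S Xg' (realize_incl QQ' Q'S).
by rewrite mul1g mulg1.
Qed.

(** An isomorphism is a morphism onto its target: the factorization axiom makes
    the inverse a morphism, as Xiso_corestr shows. *)
Definition Xiso P Q g := (realize P g \in XX P Q) && (g.1 @: P == Q).

Lemma Xiso_corestr P Q R g : P \subset S -> Q \subset S ->
  realize P g \in XX P Q -> g.1 @: P = R -> Xiso P R g /\ Xiso R P g^-1.
Proof.
move=> PS QS Xg PR; have [gM gPQ _] := realize_hom PS QS Xg.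
have [R0 [R0Q [v]]] := fas_factor PS QS Xg.
have R0S := subset_trans R0Q QS.
rewrite inE => /andP[Xv /exists_inP[w Xw /andP[/eqP wv /eqP vw]]].
rewrite (ucomp_idl PS R0S Xv) => def_v; rewrite -{v}def_v in Xv wv vw.
have [_ gPR0 _] := realize_hom PS R0S Xv.
have [k def_w] := realizeP R0S PS Xw; rewrite {w}def_w in Xw wv vw.
have [kM kR0P _] := realize_hom R0S PS Xw.
rewrite (realize_comp gPR0 kM) -realize1 in wv.
rewrite (realize_comp kR0P gM) -realize1 in vw.
have [_ gk2] := realize_eqP wv; have [kg1 _] := realize_eqP vw.
have defR : R0 = R.
  (* The intermediate group of the factorization is the image of P. *)
  apply/val_inj; rewrite /= -PR; apply/setP=> y.
  apply/idP/imsetP=> [R0y | [z Pz ->]]; last exact: gPR0.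
  by exists (k.1 y); rewrite ?kR0P // -permM kg1 ?perm1.
rewrite {R0}defR in R0Q R0S Xv Xw kg1 {gPR0 kM kR0P wv vw}.
have def_k : realize R g^-1 = realize R k.
  apply: eq_realize => [y Ry | ] /=.
    by apply: (perm_inj (s := g.1)); rewrite permKV -permM kg1 ?perm1.
  by apply/eqP; rewrite eq_invg_mul; apply/eqP.
rewrite /Xiso def_k Xv Xw PR eqxx; split=> //=; rewrite -PR -imset_comp.
by rewrite (eq_imset _ (permK g.1)) imset_id.
Qed.

Lemma Xiso_hom P Q g : P \subset S -> Q \subset S -> Xiso P Q g ->
  [/\ {in P &, {morph g.1 : y z / y * z}}, g.1 @: P = Q
    & {in P, forall y, ell a y ^ g.2 = ell a (g.1 y)}].
Proof. by move=> PS QS /andP[/(realize_hom PS QS)[gM _ tw] /eqP PQ]. Qed.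

Lemma Xiso_inv P Q g : P \subset S -> Q \subset S -> Xiso P Q g -> Xiso Q P g^-1.
Proof.
by move=> PS QS /andP[Xg /eqP PQ]; have [] := Xiso_corestr PS QS Xg PQ.
Qed.

Lemma Xiso_comp P Q R g h : P \subset S -> Q \subset S -> R \subset S ->
  Xiso P Q g -> Xiso Q R h -> Xiso P R (g * h).
Proof.
move=> PS QS RS /andP[Xg /eqP PQ] /andP[Xh /eqP QR].
rewrite /Xiso (realize_comp_mem PS QS RS Xg Xh) /=.
by rewrite (eq_imset _ (permM g.1 h.1)) (imset_comp h.1) PQ QR.
Qed.

Lemma Xiso_fas_iso P Q g : P \subset S -> Q \subset S -> Xiso P Q g ->
  realize P g \in fas_iso XX P Q.
Proof.
move=> PS QS isog; have /andP[Xg _] := isog.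
have isoV := Xiso_inv PS QS isog; have /andP[XV _] := isoV.
have [gM PQ _] := Xiso_hom PS QS isog; have [VM QP _] := Xiso_hom QS PS isoV.
rewrite inE Xg; apply/exists_inP; exists (realize Q g^-1) => //.
have gPQ : {in P, forall y, g.1 y \in Q} by move=> y Py; rewrite -PQ imset_f.
have VQP : {in Q, forall y, g^-1.1 y \in P} by move=> y Qy; rewrite -QP imset_f.
by rewrite !realize_comp // mulgV mulVg !realize1 !eqxx.
Qed.

Lemma fas_isoP P Q u : P \subset S -> Q \subset S -> u \in fas_iso XX P Q ->
  exists2 g, u = realize P g & Xiso P Q g.
Proof.
move=> PS QS; rewrite inE => /andP[Xu /exists_inP[v Xv /andP[_ /eqP uv]]].
have [g def_u] := realizeP PS QS Xu; exists g => //; rewrite {u}def_u in Xu uv *.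
rewrite /Xiso Xu /=; have [k def_v] := realizeP QS PS Xv.
rewrite {v}def_v in Xv uv; have [_ kQP _] := realize_hom QS PS Xv.
have [gM gPQ _] := realize_hom PS QS Xu.
rewrite (realize_comp kQP gM) -realize1 in uv; have [kg1 _] := realize_eqP uv.
apply/eqP/setP=> y; apply/imsetP/idP=> [[z Pz ->] | Qy]; first exact: gPQ.
by exists (k.1 y); rewrite ?kQP // -permM kg1 ?perm1.
Qed.

Lemma FconjP P Q : P \subset S -> Q \subset S ->
  Fconj XX P Q <-> exists g, Xiso P Q g.
Proof.
move=> PS QS; split.
  case=> _ [_ [/imsetP[u Xu ->] /imsetP[v Xv ->] _ uv]].
  have [g def_u] := realizeP PS QS Xu; exists g; rewrite {u}def_u in Xu uv.
  have [k def_v] := realizeP QS PS Xv; rewrite {v}def_v in Xv uv.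
  have [_ kQP _] := realize_hom QS PS Xv; have [_ gPQ _] := realize_hom PS QS Xu.
  rewrite /Xiso Xu; apply/eqP/setP=> y.
  apply/imsetP/idP=> [[z Pz ->] | Qy]; first exact: gPQ.
  have /ffunP/(_ y) := uv; rewrite !ffunE Qy kQP // => def_y.
  by exists (k.1 y); rewrite ?kQP.
case=> g /(Xiso_fas_iso PS QS).
rewrite inE => /andP[Xg /exists_inP[v Xv /andP[/eqP[vg _] /eqP[gv _]]]].
by exists (realize P g).1, v.1; split=> //; apply: imset_f.
Qed.

Local Notation A P := (autset2 P%G (XX P%G P%G)).

Lemma mem_aut2 P (T : {set mor}) b :
  (b \in autset2 P T) = (b.1 \in Aut P) && (realize P b \in T).
Proof. by rewrite inE. Qed.

Lemma aut2_Xiso P b : b \in A P -> Xiso P P b.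
Proof.
rewrite inE => /andP[Pb Xb]; rewrite /Xiso Xb /=.
by move: Pb; rewrite inE => /andP[/im_perm_on->].
Qed.

(** An endomorphism of P is realized by a permutation that fixes every element
    outside P, so it has a realization in the group X(P). *)
Lemma realize_aut2 P u : P \subset S -> u \in XX P P ->
  exists2 b, b \in A P & u = realize P b.
Proof.
move=> PS Xu; have [g def_u] := realizeP PS PS Xu; rewrite {u}def_u in Xu *.
have [gM gP _] := realize_hom PS PS Xu.
have PP : g.1 @: P = P.
  apply/eqP; rewrite eqEcard card_imset ?leqnn ?andbT; last exact: perm_inj.
  by apply/subsetP=> _ /imsetP[y Py ->]; apply: gP.
have nPg : g.1 \in 'N(P | 'P).
  apply/astabsP=> y; rewrite /= apermE -[in LHS]PP mem_imset //.
  exact: perm_inj.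
have rE y : y \in P -> restr_perm P g.1 y = g.1 y by apply: restr_permE.
have def_g : realize P g = realize P (restr_perm P g.1, g.2).
  by apply: eq_realize => //= y Py; rewrite rE.
exists (restr_perm P g.1, g.2) => //; rewrite mem_aut2 -def_g Xu andbT inE.
rewrite restr_perm_on; apply/morphicP=> y z Py Pz.
by rewrite !rE ?groupM ?gM.
Qed.

Lemma restr_Aut_inj P :
  {in Aut P &, forall b c : {perm gT}, restr P b = restr P c -> b = c}.
Proof.
move=> b c Ab Ac /ffunP bc; apply: eq_Aut Ab Ac _ => y Py.
by have := bc y; rewrite !ffunE Py.
Qed.

Lemma realize_inj P b c : b.1 \in Aut P -> c.1 \in Aut P ->
  realize P b = realize P c -> b = c.
Proof.
case: b c => [b s] [c t] /= Ab Ac [bc ->].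
by rewrite (restr_Aut_inj Ab Ac bc).
Qed.

Lemma Aut_conj P Q (b f : {perm gT}) : b \in Aut P ->
  {in P &, {morph f : y z / y * z}} -> f @: P = Q -> b ^ f \in Aut Q.
Proof.
move=> Ab fM PQ; have bon : perm_on P b by move: Ab; rewrite inE => /andP[].
have bfE y : (b ^ f) (f y) = f (b y) by rewrite permJ.
rewrite inE; apply/andP; split.
  apply/subsetP=> y; rewrite inE; apply: contraR; rewrite -(permKV f y) bfE.
  rewrite -PQ mem_imset => [nPy|]; last exact: perm_inj.
  by rewrite (out_perm bon nPy).
apply/morphicP=> y' z'; rewrite -PQ => /imsetP[y Py ->] /imsetP[z Pz ->].
rewrite -fM // !bfE -fM ?Aut_closed //; congr (f _).
by rewrite -!(autmE Ab) morphM.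
Qed.

Lemma aut2_conj P Q g : P \subset S -> Q \subset S -> Xiso P Q g ->
  A P :^ g = A Q.
Proof.
have sub P' Q' k : P' \subset S -> Q' \subset S -> Xiso P' Q' k ->
  A P' :^ k \subset A Q'.
  move=> PS QS isok; apply/subsetP=> _ /imsetP[b Ab ->].
  have [kM PQ _] := Xiso_hom PS QS isok.
  have isoV := Xiso_inv PS QS isok.
  have isob := Xiso_comp PS PS QS (aut2_Xiso Ab) isok.
  have /andP[Xb _] := Xiso_comp QS PS QS isoV isob.
  rewrite mem_aut2 conjgE Xb andbT.
  apply: (@Aut_conj P' Q' b.1 k.1) => //.
  by move: Ab; rewrite inE => /andP[].
move=> PS QS isog; apply/eqP; rewrite eqEsubset sub //.
by rewrite -sub_conjgV sub // Xiso_inv.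
Qed.
(** The inverse makes this a group morphism on 'N_S(P): ell reverses products
    in {perm X}, and conj_aut P n is conjugation by n^-1 in left notation.
    Hence inner P n realizes SXmor a P n^-1. *)
Definition inner P (n : gT) : W := (conj_aut P n, ell a n^-1).

Lemma innerM P : {in 'N_S(P) &, {morph inner P : m n / m * n}}.
Proof.
move=> m n /setIP[Sm Nm] /setIP[Sn Nn]; congr (_, _).
  by rewrite conj_aut_morphM.
by rewrite invMg ellM ?groupV.
Qed.

Canonical inner_morphism P := Morphism (@innerM P).

Lemma restr_conj_aut P n : n \in 'N(P) -> restr P (conj_aut P n) = cmap P n^-1.
Proof.
move=> Nn; apply/ffunP=> y; rewrite !ffunE; case: ifP => // Py.
by rewrite norm_conj_autE // conjgE invgK mulgA.
Qed.

Lemma conj_aut_Aut P n : conj_aut P n \in Aut P.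
Proof. exact: Aut_aut. Qed.

Lemma autset_cmap P (K : {set gT}) : K \subset 'N(P) ->
    {in K, forall n, n^-1 \in K} ->
  autset P [set cmap P s | s in K] = conj_aut P @: K.
Proof.
move=> NK KV; apply/setP=> b; rewrite inE; apply/andP/imsetP.
  case=> Pb /imsetP[n Kn def_b]; exists n^-1; first exact: KV.
  apply: (restr_Aut_inj Pb (conj_aut_Aut _ _)).
  by rewrite def_b restr_conj_aut ?invgK // groupV (subsetP NK).
case=> n Kn ->; split; first exact: conj_aut_Aut.
by rewrite restr_conj_aut ?(subsetP NK) // imset_f ?KV.
Qed.

Lemma realize_inner P n : n \in 'N(P) -> realize P (inner P n) = SXmor a P n^-1.
Proof. by move=> Nn; rewrite /realize restr_conj_aut. Qed.

Lemma autset2_AutSX P : autset2 P (AutSX a P) = inner P @* 'N_S(P).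
Proof.
rewrite morphimEdom; apply/setP=> b; rewrite mem_aut2; apply/andP/imsetP.
  case=> Pb /imsetP[n Nn def_b]; exists n^-1; first by rewrite groupV.
  apply: (@realize_inj P) => //; first exact: conj_aut_Aut.
  by rewrite def_b realize_inner ?invgK // groupV; case/setIP: Nn.
case=> n Nn ->; split; first exact: conj_aut_Aut.
rewrite realize_inner; last by case/setIP: Nn.
by apply/imsetP; exists n^-1; rewrite ?groupV.
Qed.

Lemma inner_aut2 P n : P \subset S -> n \in 'N_S(P) -> inner P n \in A P.
Proof.
move=> PS Nn; rewrite mem_aut2 conj_aut_Aut realize_inner ?SXmorP ?groupV //.
by case/setIP: Nn.
Qed.

(** * Normalizers, and extension of morphisms *)

Section Transport.

Variables (N P Q : {group gT}) (g : W).
Hypotheses (NS : N \subset S) (PN : P \subset N).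
Hypotheses (Xg : realize N g \in XX N S) (PQ : g.1 @: P = Q).

Lemma transport_norm n : n \in N -> n \in 'N(P) -> g.1 n \in 'N_S(Q).
Proof.
have [gM gNS _] := realize_hom NS (subxx S) Xg => Nn nPn.
rewrite inE gNS //= inE; apply/subsetP=> _ /imsetP[q Qq ->].
move: Qq; rewrite -PQ => /imsetP[y Py ->].
have Ny := subsetP PN y Py.
by rewrite -(perm_morphJ gM) //= imset_f ?memJ_norm.
Qed.

(** If g restricts to a morphism phi on a group containing P and n, then
    phi c_n phi^-1 = c_(phi n) on the image of P. *)
Lemma transport_inner n : n \in N -> n \in 'N(P) -> inner P n ^ g = inner Q (g.1 n).
Proof.
have [gM gNS tw] := realize_hom NS (subxx S) Xg => Nn nPn.
have /setIP[_ nQn] := transport_norm Nn nPn.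
have gMP : {in P &, {morph g.1 : y z / y * z}}.
  by move=> y z Py Pz; apply: gM; apply: subsetP PN _ _.
congr (_, _); last first.
  by rewrite -(perm_morphV gM) // -tw ?groupV // conjgE.
have Qcg : conj_aut P n ^ g.1 \in Aut Q.
  exact: Aut_conj (conj_aut_Aut _ _) gMP PQ.
apply: (eq_Aut Qcg (conj_aut_Aut _ _)) => q; rewrite -PQ => /imsetP[y Py ->].
have Qgy : g.1 y \in Q by rewrite -PQ imset_f.
by rewrite permJ !norm_conj_autE // (perm_morphJ gM) // (subsetP PN).
Qed.

End Transport.

(** In W the membership condition of the extender is that conjugation by g takes
    (c_n, ell_n) to a pair coming from 'N_S(Q). *)
Lemma mem_extender P Q g n : P \subset S -> Q \subset S -> Xiso P Q g ->
  (n \in extender a P Q (realize P g)) =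
    (n \in 'N_S(P)) && (inner P n ^ g \in inner Q @* 'N_S(Q)).
Proof.
move=> PS QS isog; rewrite inE; apply: andb_id2l => Nn.
have [gM PQ _] := Xiso_hom PS QS isog.
have [VM QP _] := Xiso_hom QS PS (Xiso_inv PS QS isog).
have Nn' : n^-1 \in 'N_S(P) by rewrite groupV.
have /andP[XcP /eqP PP] := aut2_Xiso (inner_aut2 PS Nn').
have [cM _ _] := realize_hom PS PS XcP.
rewrite (realize_uinv (perm_morph1 gM) PQ) -[n in SXmor _ _ n]invgK.
rewrite -realize_inner; last by case/setIP: Nn'.
have sP : {in P, forall y, (inner P n^-1).1 y \in P}.
  by move=> y Py; rewrite -PP imset_f.
have sQ : {in Q, forall y, g^-1.1 y \in P} by move=> y Qy; rewrite -QP imset_f.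
rewrite (realize_comp sQ) // (realize_comp (Q := P)) //; last first.
  by move=> y Qy; rewrite permM sP ?sQ.
rewrite -mulgA -conjgE (morphV (inner_morphism P)) //= conjVg.
have AQ : (inner P n ^ g)^-1.1 \in Aut Q.
  by rewrite groupV; apply: (@Aut_conj P Q _ g.1); rewrite ?conj_aut_Aut.
have := mem_aut2 Q (AutSX a Q) (inner P n ^ g)^-1.
by rewrite AQ autset2_AutSX groupV.
Qed.

Lemma ellV s : s \in S -> ell a s^-1 = (ell a s)^-1.
Proof.
move=> Ss; apply/eqP.
by rewrite eq_sym eq_invg_mul -ellM ?groupV // mulVg ell1.
Qed.

(** For L a product of trivial or full factors this is one of the four groups
    that define the extremal subgroups: see normInT, normIn_ker, normIn_cent
    and normIn1. *)
Definition normIn (L : {set W}) P : {set gT} := [set n in 'N_S(P) | inner P n \in L].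

Lemma normInT P : normIn (setX setT setT) P = 'N_S(P).
Proof. by apply/setP=> n; rewrite inE in_setX !in_setT !andbT. Qed.

Lemma conj_aut_eq1 P n : n \in 'N(P) -> (conj_aut P n == 1) = (n \in 'C(P)).
Proof. by move=> Nn; rewrite -ker_conj_aut; apply/eqP/(kerP _ Nn). Qed.

Lemma normIn_ker P : normIn (setX setT 1) P = normX a P.
Proof.
apply/setP=> n; rewrite inE in_setX in_setT in_set1 [RHS]in_setI.
apply: andb_id2l => /setIP[Sn _].
by rewrite [RHS]inE Sn /= ellV // eq_invg1.
Qed.

Lemma normIn_cent P : normIn (setX 1 setT) P = 'C_S(P).
Proof.
apply/setP=> n; rewrite inE in_setX in_setT in_set1 andbT.
apply/andP/setIP=> [[/setIP[Sn Nn]] | [Sn Cn]]; first by rewrite conj_aut_eq1.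
have Nn := subsetP (cent_sub P) n Cn.
by rewrite inE Sn Nn conj_aut_eq1.
Qed.

Lemma normIn1 P : normIn (setX 1 1) P = centX a P.
Proof.
apply/setP=> n; rewrite /centX -normIn_cent inE in_setX [RHS]in_setI.
rewrite [in RHS]inE in_setX in_setT andbT -andbA.
apply: andb_id2l => /setIP[Sn _].
have -> : (n \in action_ker a) = (ell a n == 1) by rewrite inE Sn.
by rewrite !in_set1 /= ellV // eq_invg1.
Qed.

Definition extension_property : Prop :=
  forall P Q u, P \subset S -> Q \subset S -> fully_Xcentralized XX Q ->
    u \in fas_iso XX P Q ->
  exists2 phi : {ffun gT -> gT},
    (phi, u.2) \in XX <<extender a P Q u>>%G S & {in P, phi =1 u.1}.

(** The form in which the extension axiom is applied: it suffices to check the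
    extender condition on the group N to which g is to be extended. *)
Lemma extension_realize P Q N g : extension_property ->
    P \subset N -> N \subset 'N_S(P) -> Q \subset S -> fully_Xcentralized XX Q ->
    Xiso P Q g -> {in N, forall n, inner P n ^ g \in inner Q @* 'N_S(Q)} ->
  exists h, [/\ h.2 = g.2, {in P, h.1 =1 g.1} & realize N h \in XX N S].
Proof.
move=> ext PN NP QS cQ isog cN.
have [NS PS] : N \subset S /\ P \subset S.
  have NS := subset_trans NP (subsetIl S 'N(P)).
  by rewrite NS (subset_trans PN).
have NE : N \subset <<extender a P Q (realize P g)>>%G.
  apply: subset_trans (subset_gen _); apply/subsetP=> n Nn.
  by rewrite mem_extender // (subsetP NP) // cN.
have ES : <<extender a P Q (realize P g)>>%G \subset S.
  by rewrite gen_subG; apply/subsetP=> n; rewrite inE => /andP[/setIP[]].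
have [phi Xphi phig] := ext P Q _ PS QS cQ (Xiso_fas_iso PS QS isog).
have [h def_h] := realizeP ES (subxx S) Xphi; exists h.
have [def_phi def_h2] := def_h; split=> [|y Py|] //.
  have Ny := subsetP NE y (subsetP PN y Py).
  by have:= phig y Py; rewrite def_phi !ffunE Ny Py.
by apply: (realize_sub NE (subxx S) ES (subxx S)); rewrite -def_h.
Qed.
(** Conjugation by g takes Aut_S(P; X) to a p-subgroup of X(Q), which some c in
    X(Q) moves into the Sylow subgroup Aut_S(Q; X).  Then the extender of g * c
    is the whole of 'N_S(P). *)
Lemma Xiso_receptive (p : nat) P Q g : p.-group S -> extension_property ->
    P \subset S -> Q \subset S -> fully_Xcentralized XX Q ->
    p.-Sylow(A Q) (inner Q @* 'N_S(Q)) -> Xiso P Q g ->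
  exists2 h, Xiso P Q h & realize 'N_S(P) h \in XX 'N_S(P) S.
Proof.
move=> pS ext PS QS cQ sylQ isog.
have NS : 'N_S(P) \subset S := subsetIl S 'N(P).
have BP : inner P @* 'N_S(P) \subset A P.
  by apply/subsetP=> _ /morphimP[n _ Nn ->]; apply: inner_aut2.
pose AQ := Group (XX_group_set XX QS).
have BgA : (inner P @* 'N_S(P)) :^ g \subset AQ.
  by rewrite /= -(aut2_conj PS QS isog) conjSg.
have pBg : p.-group ((inner P @* 'N_S(P)) :^ g).
  by rewrite pgroupJ morphim_pgroup // (pgroupS NS).
have [c Ac BcQ] :=
  @Sylow_Jsub p _ AQ _ ((inner P @* 'N_S(P)) :^ g)%G sylQ BgA pBg.
have isogc := Xiso_comp PS QS QS isog (aut2_Xiso Ac).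
have PN : P \subset 'N_S(P) by rewrite subsetI PS normG.
have [n Nn | h [h2 hP Xh]] :=
    extension_realize ext PN (subxx _) QS cQ isogc.
  by rewrite conjgM (subsetP BcQ) // !memJ_conjg mem_morphim.
exists h => //; have /andP[Xgc /eqP PQ] := isogc.
by rewrite /Xiso (eq_realize hP h2) Xgc -PQ (eq_in_imset hP) eqxx.
Qed.

Lemma transport_normIn (L : {group W}) N P Q g n : (forall b, b \in 'N(L)) ->
    N \subset S -> P \subset N -> realize N g \in XX N S -> g.1 @: P = Q ->
    n \in N -> n \in 'N_S(P) ->
  (g.1 n \in normIn L Q) = (n \in normIn L P).
Proof.
move=> nL NS PN Xg PQ Nn NPn; have /setIP[_ nPn] := NPn.
rewrite inE [RHS]inE NPn (transport_norm NS PN Xg PQ) //=.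
by rewrite -(transport_inner NS PN Xg PQ) // memJ_norm.
Qed.

Lemma transport_normIn_sub (L : {group W}) N P Q g : (forall b, b \in 'N(L)) ->
    N \subset S -> P \subset N -> realize N g \in XX N S -> g.1 @: P = Q ->
    normIn L P \subset N ->
  g.1 @: normIn L P \subset normIn L Q.
Proof.
move=> nL NS PN Xg PQ /subsetP LN; apply/subsetP=> _ /imsetP[n Ln ->].
rewrite (transport_normIn nL NS PN Xg PQ) ?LN //.
by move: Ln; rewrite inE => /andP[].
Qed.

Lemma inner_normIn L P : inner P @: normIn L P = inner P @* 'N_S(P) :&: L.
Proof.
rewrite morphimEdom; apply/setP=> b; apply/imsetP/setIP.
  by case=> n; rewrite inE => /andP[Nn Ln] ->; rewrite imset_f.
by case=> /imsetP[n Nn ->] Ln; exists n; rewrite // inE Nn.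
Qed.

(** * A criterion for saturation *)

Section Criterion.

Variables (p : nat) (P0 : {group gT}).
Hypotheses (pS : p.-group S) (ext : extension_property) (P0S : P0 \subset S).
Hypotheses (cP0 : fully_Xcentralized XX P0).
Hypothesis sylP0 : p.-Sylow(A P0) (inner P0 @* 'N_S(P0)).

Implicit Types L : {group W}.

Local Notation fullyin L := (fully XX (fun P => #|normIn L P|)).

Lemma receptive_to P : P \subset S -> Fconj XX P P0 ->
  exists h, [/\ Xiso P P0 h, h.1 @: P = P0 & realize 'N_S(P) h \in XX 'N_S(P) S].
Proof.
move=> PS /(FconjP PS P0S)[g isog].
have [h isoh Xh] := Xiso_receptive pS ext PS P0S cP0 sylP0 isog.
by exists h; split=> //; have [] := Xiso_hom PS P0S isoh.
Qed.

Lemma normIn_image L P h : (forall b, b \in 'N(L)) -> P \subset S ->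
    h.1 @: P = P0 -> realize 'N_S(P) h \in XX 'N_S(P) S ->
  h.1 @: normIn L P \subset normIn L P0.
Proof.
move=> nL PS PP0 Xh.
apply: (transport_normIn_sub nL _ _ Xh PP0); first exact: subsetIl.
  by rewrite subsetI PS normG.
by apply/subsetP=> n; rewrite inE => /andP[].
Qed.

Lemma leq_normIn L P : (forall b, b \in 'N(L)) -> P \subset S ->
  Fconj XX P P0 -> #|normIn L P| <= #|normIn L P0|.
Proof.
move=> nL PS /(receptive_to PS)[h [_ PP0 Xh]].
rewrite -(card_imset _ (@perm_inj _ h.1)).
exact: subset_leq_card (normIn_image nL PS PP0 Xh).
Qed.

Lemma fully_image L P h : (forall b, b \in 'N(L)) -> P \subset S ->
    Fconj XX P P0 -> h.1 @: P = P0 -> realize 'N_S(P) h \in XX 'N_S(P) S ->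
    fullyin L P ->
  h.1 @: normIn L P = normIn L P0.
Proof.
move=> nL PS conjP PP0 Xh fP; apply/eqP; rewrite eqEcard normIn_image //.
by rewrite card_imset ?fP //; apply: perm_inj.
Qed.

Lemma Fconj_euclid P Q R : P \subset S -> Q \subset S -> R \subset S ->
  Fconj XX P Q -> Fconj XX P R -> Fconj XX Q R.
Proof.
move=> PS QS RS /(FconjP PS QS)[g isog] /(FconjP PS RS)[h isoh].
by apply/FconjP=> //; exists (g^-1 * h); apply: Xiso_comp isoh; rewrite ?Xiso_inv.
Qed.

(** If P is extremal for L1, then h : 'N_S(P) -> 'N_S(P0) is onto from the L1-part
    of P to that of P0.  It preserves membership in L2, hence is onto for the
    smaller L2 as well, where P0 attains the maximum. *)
Lemma fully_subset L1 L2 P : (forall b, b \in 'N(L1)) ->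
    (forall b, b \in 'N(L2)) -> L2 \subset L1 ->
    P \subset S -> Fconj XX P P0 ->
  fullyin L1 P -> fullyin L2 P.
Proof.
move=> nL1 nL2 L21 PS conjP fP Q QS conjQ.
have [h [_ PP0 Xh]] := receptive_to PS conjP.
apply: leq_trans (leq_normIn nL2 QS (Fconj_euclid PS QS P0S conjQ conjP)) _.
rewrite -[X in _ <= X](card_imset _ (@perm_inj _ h.1)).
apply/subset_leq_card/subsetP=> n L2n.
have : n \in normIn L1 P0.
  by case/setIdP: L2n => Nn L2n; apply/setIdP; rewrite Nn (subsetP L21).
rewrite -(fully_image nL1 PS conjP PP0 Xh fP) => /imsetP[m L1m def_n].
have Nm : m \in 'N_S(P) by move: L1m; rewrite inE => /andP[].
rewrite def_n imset_f // -(transport_normIn nL2 _ _ Xh PP0) -?def_n //.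
  exact: subsetIl.
by rewrite subsetI PS normG.
Qed.

(** At P0, intersecting a Sylow subgroup with the normal subgroup X(P0) :&: L
    gives a Sylow subgroup of the latter.  As P is extremal for L, conjugation by
    h identifies the pair of groups at P with the pair at P0. *)
Lemma fully_Sylow L P : (forall b, b \in 'N(L)) -> P \subset S ->
    Fconj XX P P0 -> fullyin L P ->
  p.-Sylow(A P :&: L) (inner P @* 'N_S(P) :&: L).
Proof.
move=> nL PS conjP fP.
have [h [isoh PP0 Xh]] := receptive_to PS conjP.
have NS : 'N_S(P) \subset S := subsetIl _ _.
have PN : P \subset 'N_S(P) by rewrite subsetI PS normG.
have cjh : (inner P @: normIn L P) :^ h = inner P0 @: normIn L P0.
  rewrite -(fully_image nL PS conjP PP0 Xh fP) /conjugate -!imset_comp.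
  apply: eq_in_imset => n; rewrite inE => /andP[Nn _] /=.
  by rewrite (transport_inner NS PN Xh PP0) //; case/setIP: Nn.
pose AP := Group (XX_group_set XX PS).
rewrite -(pHallJ2 _ (AP :&: L)%G (inner P @* 'N_S(P) :&: L)%G h) /=.
rewrite -inner_normIn cjh conjIg (aut2_conj PS P0S isoh).
rewrite (normP (nL h)) inner_normIn.
pose AP0 := Group (XX_group_set XX P0S).
have nsA : AP0 :&: L <| AP0.
  by rewrite /normal subsetIl normsI ?normG //; apply/subsetP=> b _; apply: nL.
have := Hall_setI_normal nsA sylP0.
by rewrite setIA (setIidPl (pHall_sub sylP0)).
Qed.

End Criterion.
Lemma mem_setX (L1 : {set {perm gT}}) (L2 : {set {perm X}}) b :
  (b \in setX L1 L2) = (b.1 \in L1) && (b.2 \in L2).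
Proof. by rewrite inE. Qed.

Lemma norm_setX (L1 : {group {perm gT}}) (L2 : {group {perm X}}) :
    (forall f, f \in 'N(L1)) -> (forall s, s \in 'N(L2)) ->
  forall b, b \in 'N(setX L1 L2).
Proof.
move=> n1 n2 b; rewrite inE; apply/subsetP=> _ /imsetP[c + ->].
rewrite !mem_setX => /andP[c1 c2]; apply/andP; split.
  by rewrite -(memJ_norm c.1 (n1 b.1)) in c1.
by rewrite -(memJ_norm c.2 (n2 b.2)) in c2.
Qed.

(** Here and in the lemmas that follow: the groups in the Sylow axioms are the
    images, under the projections of W, of X(P) :&: L and of the intersection of
    L with the image of inner P. *)
Lemma autset_Fhom P : P \subset S -> autset P (Fhom XX P P) = fst @: A P.
Proof.
move=> PS; apply/setP=> b; rewrite inE; apply/andP/imsetP.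
  case=> Pb /imsetP[u Xu def_b]; have [c Ac def_u] := realize_aut2 PS Xu.
  exists c => //; apply: (restr_Aut_inj Pb); last by rewrite def_b def_u.
  by move: Ac; rewrite mem_aut2 => /andP[].
case=> c; rewrite mem_aut2 => /andP[Pc Xc] ->; split=> //.
by apply/imsetP; exists (realize P c).
Qed.

Lemma SigmaX_snd P : P \subset S -> SigmaX XX P = snd @: A P.
Proof.
move=> PS; apply/setP=> s; apply/imsetP/imsetP=> [[u Xu ->] | [c Ac ->]].
  by have [c Ac ->] := realize_aut2 PS Xu; exists c.
by exists (realize P c) => //; move: Ac; rewrite mem_aut2 => /andP[].
Qed.

Lemma autset_F0 P : autset P (Defs.F0 XX P) = fst @: (A P :&: setX setT 1).
Proof.
apply/setP=> b; rewrite in_set [restr _ _ \in _]in_set.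
apply/andP/imsetP=> [[Pb Xb] | [c]].
  by exists (b, 1) => //; rewrite in_setI mem_aut2 Pb Xb mem_setX !inE eqxx.
rewrite in_setI mem_aut2 mem_setX => /andP[/andP[Pc Xc] /andP[_ /set1P c2]] ->.
by rewrite Pc; split; rewrite // -c2.
Qed.

Lemma SigmaX0_snd P : SigmaX0 XX P = snd @: (A P :&: setX 1 setT).
Proof.
apply/setP=> s; rewrite inE; apply/idP/imsetP=> [Xs | [c]].
  exists (1, s) => //.
  by rewrite in_setI mem_aut2 group1 /realize restr1 Xs mem_setX !inE eqxx.
rewrite in_setI mem_aut2 mem_setX => /andP[/andP[Pc Xc] /andP[/set1P c1 _]] ->.
by rewrite -(restr1 P) -c1.
Qed.

Lemma fst_inner P (K : {set gT}) :
    K \subset 'N(P) -> {in K, forall n, n^-1 \in K} ->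
  autset P [set cmap P s | s in K] = fst @: (inner P @: K).
Proof. by move=> NK KV; rewrite autset_cmap // -imset_comp. Qed.

Lemma snd_inner P (K : {set gT}) : {in K, forall n, n^-1 \in K} ->
  [set ell a s | s in K] = snd @: (inner P @: K).
Proof.
move=> KV; rewrite -imset_comp; apply/setP=> s.
by apply/imsetP/imsetP=> -[n Kn ->]; exists n^-1; rewrite /= ?invgK ?KV.
Qed.

Lemma normX_inv P : {in normX a P, forall n, n^-1 \in normX a P}.
Proof.
move=> n; rewrite /normX !in_setI !groupV => /andP[Nn].
rewrite inE => /andP[Sn /eqP kn]; rewrite Nn inE groupV Sn ellV // kn.
by rewrite invg1 eqxx.
Qed.

Lemma eq_fully (m1 m2 : {group gT} -> nat) P :
  m1 =1 m2 -> fully XX m1 P -> fully XX m2 P.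
Proof. by move=> eqm f1 Q QS conjQ; rewrite -!eqm f1. Qed.

(** Each axiom is fully_subset or fully_Sylow for a suitable L: the trivial second
    factor cuts out the pairs (phi, id_X), the trivial first factor the pairs
    (id_P, sigma).  Projections of W preserve Sylow subgroups, which reduces the
    axioms on F(P) and Sigma(P) to the one on X(P). *)
Theorem saturated_criterion (p : nat) : p.-group S -> extension_property ->
    (forall P, P \subset S -> exists P0 : {group gT},
       [/\ P0 \subset S, Fconj XX P P0, fully_Xcentralized XX P0
         & p.-Sylow(A P0) (inner P0 @* 'N_S(P0))]) ->
  saturated XX p.
Proof.
move=> pS ext rep.
pose T1 := [set: {perm gT}]%G; pose T2 := [set: {perm X}]%G.
pose U1 : {group {perm gT}} := 1%G; pose U2 : {group {perm X}} := 1%G.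
pose LN := setX_group T1 T2; pose LX := setX_group T1 U2.
pose LC := setX_group U1 T2; pose LZ := setX_group U1 U2.
have nT (rT : finGroupType) (b : rT) : b \in 'N([set: rT]).
  by rewrite (subsetP (normG _)) ?inE.
have n1 (rT : finGroupType) (b : rT) : b \in 'N(1 : {set rT}).
  by rewrite norm1 inE.
have nLN b : b \in 'N(LN) := norm_setX (nT _) (nT _) b.
have nLX b : b \in 'N(LX) := norm_setX (nT _) (n1 _) b.
have nLC b : b \in 'N(LC) := norm_setX (n1 _) (nT _) b.
have nLZ b : b \in 'N(LZ) := norm_setX (n1 _) (n1 _) b.
have eqN P : #|normIn LN P| = #|'N_S(P)| by rewrite /= normInT.
have eqX P : #|normIn LX P| = #|normX a P| by rewrite /= normIn_ker.
have eqC P : #|normIn LC P| = #|'C_S(P)| by rewrite /= normIn_cent.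
have eqZ P : #|normIn LZ P| = #|centX a P| by rewrite /= normIn1.
have toN P := eq_fully (P := P) (fsym eqN).
have toX P := eq_fully (P := P) (fsym eqX).
have toC P := eq_fully (P := P) (fsym eqC).
have ofX P := eq_fully (P := P) eqX.
have ofC P := eq_fully (P := P) eqC.
have ofZ P := eq_fully (P := P) eqZ.
have sylN P : P \subset S -> fully_normalized XX P ->
    p.-Sylow(A P) (inner P @* 'N_S(P)).
  move=> PS fP; have [P0 [P0S conjP cP0 sylP0]] := rep P PS.
  have := fully_Sylow pS ext P0S cP0 sylP0 nLN PS conjP (toN P fP).
  have -> : LN = setT :> {set W} by apply/setP=> b; rewrite mem_setX !in_setT.
  by rewrite !setIT.
split.
- move=> P PS; have [P0 [P0S conjP cP0 sylP0]] := rep P PS.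
  have sub L1 L2 n1' n2' s12 :=
    @fully_subset p P0 pS ext P0S cP0 sylP0 L1 L2 P n1' n2' s12 PS conjP.
  split=> [fP | fP | fP].
  + split.
      by apply/ofX/(sub LN) => //; [rewrite setXS ?subsetT | apply: toN].
    by apply/ofC/(sub LN) => //; [rewrite setXS ?subsetT | apply: toN].
  + by apply/ofZ/(sub LX) => //; [rewrite setXS ?sub1G | apply: toX].
  by apply/ofZ/(sub LC) => //; [rewrite setXS ?sub1G | apply: toC].
- move=> P PS fP; have sylP := sylN P PS fP; rewrite autset2_AutSX.
  have NV : {in 'N_S(P), forall n, n^-1 \in 'N_S(P)} by move=> n; rewrite groupV.
  split=> //; last first.
    rewrite SigmaX_snd // /SigmaS (snd_inner P NV) -morphimEdom.
    apply: Sylow_imset sylP; first exact: snd_morphM.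
      exact: XX_group_set.
    exact: groupP.
  rewrite autset_Fhom // /AutS fst_inner ?subsetIr // -morphimEdom.
  apply: Sylow_imset sylP; first exact: fst_morphM.
    exact: XX_group_set.
  exact: groupP.
- move=> P PS fP; have [P0 [P0S conjP cP0 sylP0]] := rep P PS.
  have sylP := fully_Sylow pS ext P0S cP0 sylP0 nLX PS conjP (toX P fP).
  rewrite autset_F0 /FS0 fst_inner; last exact: normX_inv; last first.
    by apply/subsetP=> n /setIP[/setIP[]].
  rewrite -normIn_ker inner_normIn; apply: Sylow_imset sylP.
  - exact: fst_morphM.
  - exact: (groupP (Group (XX_group_set XX PS) :&: LX)).
  exact: (groupP (inner P @* 'N_S(P) :&: LX)).
- move=> P PS fP; have [P0 [P0S conjP cP0 sylP0]] := rep P PS.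
  have sylP := fully_Sylow pS ext P0S cP0 sylP0 nLC PS conjP (toC P fP).
  have CV : {in 'C_S(P), forall n, n^-1 \in 'C_S(P)} by move=> n; rewrite groupV.
  rewrite SigmaX0_snd /SigmaS0 (snd_inner P CV) -normIn_cent inner_normIn.
  apply: Sylow_imset sylP; first exact: snd_morphM.
    exact: (groupP (Group (XX_group_set XX PS) :&: LC)).
  exact: (groupP (inner P @* 'N_S(P) :&: LC)).
exact: ext.
Qed.
End System.
End Realization.
(** * The stabilizer system *)

Section Stabilizer.

Variables (gT : finGroupType) (S : {group gT}) (X : finType).
Variables (a : left_action S X) (XX : fusion_action_system a).

Local Notation W := ({perm gT} * {perm X})%type.

Implicit Types (P Q R N : {group gT}) (g h b k : W) (y z : X) (n : gT).

Local Notation St y := (stab_group a y).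

Lemma mem_stab y n : n \in S -> (n \in St y) = (ell a n y == y).
Proof. by move=> Sn; rewrite inE Sn ellE. Qed.

(** A group morphism S -> {perm X}, unlike ell, which reverses products. *)
Definition ell_inv n : {perm X} := ell a n^-1.

Lemma ell_invM : {in S &, {morph ell_inv : m n / m * n}}.
Proof. by move=> m n Sm Sn; rewrite /ell_inv invMg ellM ?groupV. Qed.

Canonical ell_inv_morphism := Morphism ell_invM.

Lemma mem_stabV y n : n \in S -> (n \in St y) = (ell_inv n y == y).
Proof. by move=> Sn; rewrite -groupV mem_stab ?groupV. Qed.

Lemma setI_stab y : ell_inv @* S :&: 'C[y | 'P] = ell_inv @* St y.
Proof.
apply/setP=> s; apply/setIP/morphimP=> [[/morphimP[n Sn _ ->]] | [n Sn Ty ->]].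
  by move/astab1P; rewrite /= apermE => ny; exists n; rewrite // mem_stabV // ny.
split; first exact: mem_morphim.
by apply/astab1P; apply/eqP; rewrite -mem_stabV.
Qed.

Lemma card_ell_stab y : (#|'ker ell_inv| * #|ell_inv @* St y| = #|St y|)%N.
Proof.
rewrite -card_morphpre ?morphimS ?stab_sub // morphimGK ?stab_sub //.
by apply/subsetP=> n /morphpreP[Sn /set1P kn]; rewrite mem_stabV // kn perm1.
Qed.

Section Group.

Local Notation G := (Group (SigmaX_group_set XX (sub1G S))).

Lemma ell_stab_sub y :
  ell_inv @* S \subset G -> ell_inv @* St y \subset 'C_G[y | 'P].
Proof.
move=> SG; rewrite -setI_stab subsetI subsetIr andbT.
exact: subset_trans (subsetIl _ _) SG.
Qed.

(** Some y = c(x) has ell(S_y) Sylow in the stabilizer of y, which has the order of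
    the stabilizer of x.  All S_z contain the kernel of the action, so that
    #|S_y| <= #|S_x| gives the same inequality for their images under ell. *)
Lemma Sylow_stab (p : nat) x :
    p.-Sylow(G) (ell_inv @* S) -> fully_stabilized a x ->
  p.-Sylow('C_G[x | 'P]) (ell_inv @* St x).
Proof.
move=> sylS fsx; have [c Gc] := Sylow_setI_conj sylS (subsetIl G 'C[x | 'P]).
rewrite conjIg conjGid // -astab1_act /= apermE; set y := c x.
rewrite [_ @* S :&: _]setICA setI_stab.
have GS := pHall_sub sylS.
have sTS z : ell_inv @* St z \subset ell_inv @* S := morphimS _ (stab_sub a z).
rewrite (setIidPr (subset_trans (sTS y) GS)).
move=> syly; have pT : p.-group (ell_inv @* St x).
  by apply: pgroupS (pHall_pgroup sylS); apply: sTS.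
have [R sylR TR] := Sylow_superset (ell_stab_sub x GS) pT.
suff -> : ell_inv @* St x = R by [].
apply/eqP; rewrite eqEcard TR.
rewrite (card_Hall sylR); have -> : #|'C_G[x | 'P]| = #|'C_G[y | 'P]|.
  by rewrite -(cardJg 'C_G[x | 'P] c) conjIg conjGid // -astab1_act.
rewrite -(@card_Hall _ _ 'C_G[y | 'P]%G (ell_inv @* St y)%G syly).
rewrite -(leq_pmul2l (cardG_gt0 ('ker ell_inv)%G)).
by rewrite !card_ell_stab fsx.
Qed.

End Group.

Lemma Fconj1 Q : Q \subset S -> Fconj XX 1%G Q -> Q = 1%G.
Proof.
move=> QS /(FconjP XX (sub1G S) QS)[g isog].
have [_ defQ _] := Xiso_hom (sub1G S) QS isog.
apply/val_inj/card1_trivg; rewrite -defQ card_imset ?cards1 //.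
exact: perm_inj.
Qed.

(** The trivial subgroup is conjugate only to itself. *)
Lemma fully1 m : fully XX m 1%G.
Proof. by move=> Q QS /(Fconj1 QS)->. Qed.

Lemma Xiso1 s : s \in SigmaX XX 1%G -> Xiso XX 1%G 1%G (1, s).
Proof.
case/imsetP=> u Xu ->; have [g def_u] := realizeP (sub1G S) (sub1G S) Xu.
rewrite def_u in Xu *; have [gM _ _] := realize_hom (sub1G S) (sub1G S) Xu.
rewrite /Xiso imset_set1 perm1 eqxx andbT.
rewrite (@eq_realize _ _ 1%G (1, g.2) g) // => y /set1P->.
by rewrite perm1 (perm_morph1 gM).
Qed.

Lemma inner_triv n : inner a 1%G n = (1, ell_inv n).
Proof.
by have := conj_aut_Aut 1%G n; rewrite /inner Aut1 => /set1P->.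
Qed.

Section FullyStabilized.

Variables (p : nat) (x : X).
Hypotheses (pS : p.-group S) (trX : fas_transitive XX).
Hypotheses (satX : saturated XX p) (fsx : fully_stabilized a x).

Let ext : extension_property XX.
Proof. by case: satX. Qed.

Let sylSigma : p.-Sylow(SigmaX XX 1%G) (ell_inv @* S).
Proof.
have [_ /(_ 1%G (sub1G S) (fully1 _))[_ _ +] _ _ _] := satX.
rewrite /SigmaS (snd_inner a 1%G) => [|n]; last by rewrite groupV.
rewrite -imset_comp morphimEdom norm1 setIT.
by rewrite (eq_imset _ (fun n => congr1 snd (inner_triv n))).
Qed.

(** A permutation of X(1) from y to x can be corrected inside the stabilizer of x
    so that it conjugates ell(S_y) into ell(S_x); its extender as a morphism of
    the trivial subgroup then contains S_y. *)
Lemma stab_to_x y : exists2 k, realize (St y) k \in XX (St y) S & k.2 y = x.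
Proof.
pose G := Group (SigmaX_group_set XX (sub1G S)).
have trG : [transitive G, on [set: X] | 'P] := trX.
have [s Gs def_x] := atransP2 trG (in_setT y) (in_setT x).
have GS : ell_inv @* S \subset G := pHall_sub sylSigma.
have sylx := Sylow_stab sylSigma fsx.
have yx : (ell_inv @* St y) :^ s \subset 'C_G[x | 'P].
  rewrite def_x astab1_act -{1}(conjGid (Gs : s \in G)) -conjIg conjSg.
  exact: ell_stab_sub.
have py : p.-group ((ell_inv @* St y) :^ s).
  rewrite pgroupJ; apply: pgroupS (pHall_pgroup sylSigma).
  exact: (morphimS _ (stab_sub a y)).
have [h /setIP[Gh /astab1P hx] shx] :=
  @Sylow_Jsub p _ _ (ell_inv @* St x)%G ((ell_inv @* St y) :^ s)%G sylx yx py.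
have isot : Xiso XX 1%G 1%G (1, s * h).
  by apply: Xiso1; apply: (groupM (Gs : s \in G) Gh).
have NT : St y \subset 'N_S(1) by rewrite norm1 setIT stab_sub.
have [n Tn | k [k2 _ Xk]] :=
    extension_realize ext (sub1G _) NT (sub1G S) (fully1 _) isot.
  have Sn : n \in S := subsetP (stab_sub a y) n Tn.
  have : (ell_inv n ^ s) ^ h \in ell_inv @* St x.
    by apply: (subsetP shx); rewrite !memJ_conjg mem_morphim.
  case/morphimP=> m Sm Tm def_m.
  have -> : inner a 1%G n ^ (1, s * h) = inner a 1%G m.
    rewrite !inner_triv; congr (_, _); first by rewrite /= mul1g mulg1 invg1.
    by rewrite -def_m -conjgM.
  by rewrite mem_morphim //= norm1 setIT.
exists k => //; rewrite k2 /= permM -[s y]/('P%act y s) -def_x.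
by rewrite -[RHS]hx.
Qed.

Local Notation T := (St x).
Local Notation aT := (stab_action a x).
Local Notation XT := (stab_system x XX).

Let TS : T \subset S := stab_sub a x.

(** By the intertwining relation ell(g n) = ell(n) ^ g, so the image of n fixes
    the image of y. *)
Lemma stab_image y z N g :
    N \subset St y -> realize N g \in XX N S -> g.2 y = z ->
  {in N, forall n, g.1 n \in St z}.
Proof.
move=> NT Xg yz n Nn; have NS := subset_trans NT (stab_sub a y).
have [_ gNS tw] := realize_hom NS (subxx S) Xg.
rewrite mem_stab ?gNS // -tw // -yz permJ.
by have := subsetP NT n Nn; rewrite mem_stab ?(subsetP NS) // => /eqP->.
Qed.

Lemma mem_stab_system P Q g :
  (realize P g \in XT P Q) = (realize P g \in XX P Q) && (g.2 x == x).
Proof. by rewrite inE. Qed.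

Lemma Xiso_stab P Q g : Xiso XT P Q g = Xiso XX P Q g && (g.2 x == x).
Proof. by rewrite /Xiso mem_stab_system andbAC. Qed.

Lemma inner_stab P n : n \in T -> inner aT P n = inner a P n.
Proof. by move=> Tn; rewrite /inner stab_ell ?groupV. Qed.

(** The representative is k(P1), with P1 a fully normalized conjugate of P in the
    large system, reached by some g, and k : S_y -> S_x the morphism of stab_to_x
    at y = g(x): then g * k fixes x, although neither factor need do so. *)
Lemma stab_representative P : P \subset T -> exists P0 : {group gT},
  [/\ P0 \subset T, Fconj XT P P0, fully_Xcentralized XX P0
    & p.-Sylow(autset2 P0 (XT P0 P0)) (inner aT P0 @* 'N_T(P0))].
Proof.
move=> PT; have PS := subset_trans PT TS.
pose conjP Q := (Q \subset S) && [exists g, Xiso XX P Q g].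
have conjPP : conjP P.
  rewrite /conjP PS; apply/existsP; exists 1.
  by rewrite /Xiso realize1 fas_id // (eq_imset _ (@perm1 _)) imset_id eqxx.
have [P1 /andP[P1S /existsP[g isog]] maxP1] :=
  @arg_maxnP _ P conjP (fun Q => #|'N_S(Q)|) conjPP.
have fP1 : fully_normalized XX P1.
  move=> Q QS /(FconjP XX P1S QS)[h isoh]; apply: maxP1; rewrite /conjP QS.
  by apply/existsP; exists (g * h); apply: Xiso_comp isoh.
have [sat1 sat2 _ _ _] := satX.
have cP1 : fully_Xcentralized XX P1.
  by have [sNX sX _] := sat1 P1 P1S; have [fX _] := sNX fP1; apply: sX.
have [_ sylP1 _] := sat2 P1 P1S fP1; rewrite autset2_AutSX in sylP1.
pose AP1 := Group (XX_group_set XX P1S); pose K := Group (XX_group_set XT PT).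
have KgA : K :^ g \subset AP1.
  rewrite /= -(aut2_conj PS P1S isog) conjSg; apply/subsetP=> b.
  by rewrite !mem_aut2 mem_stab_system => /and3P[-> ->].
(* K is X_x(P); its conjugate under g * c is the stabilizer of (g * c)(x) in
   X(P1). *)
have [c Ac sylK] :=
  @Sylow_setI_conj _ p AP1 (inner a P1 @* 'N_S(P1))%G (K :^ g)%G sylP1 KgA.
have {isog} := Xiso_comp PS P1S P1S isog (aut2_Xiso Ac).
rewrite /= -conjsgM in sylK; move: (g * c) sylK => {KgA c Ac}g sylK isog.
pose y := g.2 x; have [k Xk ky] := stab_to_x y.
have [_ PP1 _] := Xiso_hom PS P1S isog.
have P1T : P1 \subset St y.
  rewrite -PP1; apply/subsetP=> _ /imsetP[n Pn ->].
  have /andP[Xg _] := isog.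
  have XgS := realize_sub (subxx P) P1S PS (subxx S) Xg.
  exact: (stab_image PT XgS (erefl y)).
have TyS : St y \subset S := stab_sub a y.
have [kM _ _] := realize_hom TyS (subxx S) Xk.
have k1M : {in P1 &, {morph k.1 : m n / m * n}}.
  by move=> m n P1m P1n; apply: kM; apply: (subsetP P1T).
pose P0 := Group (perm_morph_group_set k1M).
have kP : k.1 @: P1 = P0 by [].
have P0T : P0 \subset T.
  apply/subsetP=> _ /imsetP[n P1n ->].
  exact: (stab_image (subxx _) Xk ky) (subsetP P1T n P1n).
have P0S := subset_trans P0T TS.
have [isok _] : Xiso XX P1 P0 k /\ Xiso XX P0 P1 k^-1.
  have Xk1 := realize_sub P1T (subxx S) TyS (subxx S) Xk.
  exact: Xiso_corestr P1S (subxx S) Xk1 kP.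
have isogk : Xiso XT P P0 (g * k).
  by rewrite Xiso_stab (Xiso_comp PS P1S P0S isog isok) /= permM -/y ky.
exists P0; split=> //; first by apply/(FconjP XT PT P0T); exists (g * k).
  (* k is defined on Z_S(P1; X), as S_y contains the kernel of the action. *)
  move=> Q QS conjQ.
  have leQ : #|centX a Q| <= #|centX a P1|.
    apply: cP1 => //; have /(FconjP XX P0S QS)[h isoh] := conjQ.
    apply/(FconjP XX P1S QS); exists (k * h); exact: Xiso_comp isoh.
  apply: leq_trans leQ _; rewrite -(card_imset _ (@perm_inj _ k.1)) -!normIn1.
  apply/subset_leq_card.
  apply: (@transport_normIn_sub _ _ _ _ XX (setX_group 1 1) (St y)) => //.
    by apply: norm_setX => b; rewrite norm1 inE.
  rewrite normIn1; apply/subsetP=> n /setIP[_]; rewrite inE => /andP[Sn /eqP kn].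
  by rewrite mem_stab // kn perm1.
(* The Sylow subgroup found at P1 is moved by k to one of X_x(P0). *)
have sylKk : p.-Sylow(autset2 P0 (XT P0 P0))
    ((inner a P1 @* 'N_S(P1) :&: K :^ g) :^ k).
  rewrite -(aut2_conj PT P0T isogk) conjsgM.
  by rewrite (pHallJ2 _ (K :^ g)%G (inner a P1 @* 'N_S(P1) :&: K :^ g)%G).
have BA : inner aT P0 @* 'N_T(P0) \subset autset2 P0 (XT P0 P0).
  by apply/subsetP=> _ /morphimP[n _ Nn ->]; apply: inner_aut2.
have pB : p.-group (inner aT P0 @* 'N_T(P0)).
  by rewrite morphim_pgroup // (pgroupS (subset_trans (subsetIl _ _) TS)).
rewrite (@sub_pHall _ p ((inner a P1 @* 'N_S(P1) :&: K :^ g) :^ k)%G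
  (Group (XX_group_set XT P0T)) (inner aT P0 @* 'N_T(P0))%G sylKk pB) //.
(* It lies in the p-group Aut_{S_x}(P0; X), hence equals it: its elements come
   from those n in N_S(P1) that fix y, and k takes such n into S_x. *)
apply/subsetP=> _ /imsetP[_ /setIP[/morphimP[n _ Nn ->] Kn] ->].
have /setIP[Sn nPn] := Nn.
have Tn : n \in St y.
  rewrite mem_stabV // /ell_inv; case/imsetP: Kn => b.
  rewrite mem_aut2 mem_stab_system.
  case/and3P=> _ _ /eqP bx /(congr1 snd) /= ->.
  by rewrite permM permM /y permK bx.
rewrite (transport_inner TyS P1T Xk kP) //.
have Nk := transport_norm TyS P1T Xk kP Tn nPn.
have Tk := stab_image (subxx _) Xk ky Tn.
have NTk : k.1 n \in 'N_T(P0) by case/setIP: Nk => _ nP0k; apply/setIP.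
by rewrite -inner_stab // mem_morphim.
Qed.

Lemma centX_stab P : P \subset T -> centX aT P = centX a P.
Proof.
move=> PT; apply/setP=> n; apply/setIP/setIP=> -[/setIP[Sn Cn]].
  by rewrite !inE stab_ell // Cn => /andP[_ ->]; rewrite (subsetP TS).
rewrite inE => /andP[_ kn].
have Tn : n \in T by rewrite mem_stab // (eqP kn) perm1.
by rewrite !in_setI Cn Tn inE Tn stab_ell.
Qed.

Lemma Fconj_stab P Q : P \subset T -> Q \subset T -> Fconj XT P Q -> Fconj XX P Q.
Proof.
move=> PT QT /(FconjP XT PT QT)[g]; rewrite Xiso_stab => /andP[isog _].
by apply/FconjP; [exact: subset_trans TS | exact: subset_trans TS | exists g].
Qed.

(** Q is conjugate in the small system to a subgroup that attains the maximum of
    the large one. *)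
Lemma fully_Xcentralized_stab Q : Q \subset T ->
  fully_Xcentralized XT Q -> fully_Xcentralized XX Q.
Proof.
move=> QT cQ; have QS := subset_trans QT TS.
have [Q0 [Q0T conjQ cQ0 _]] := stab_representative QT.
have Q0S := subset_trans Q0T TS => R RS conjR.
apply: leq_trans (cQ0 R RS _) _.
  exact: Fconj_euclid QS Q0S RS (Fconj_stab QT Q0T conjQ) conjR.
by rewrite -!centX_stab //; apply: cQ.
Qed.

(** The extender in S_x is contained in the extender in S, and the extension
    given by the large system takes it into S_x by stab_image. *)
Lemma stab_extension : extension_property XT.
Proof.
move=> P Q u PT QT cQ /(fas_isoP PT QT)[g -> isog].
have [PS QS] := (subset_trans PT TS, subset_trans QT TS).
have /andP[isogS /eqP gx] : Xiso XX P Q g && (g.2 x == x) by rewrite -Xiso_stab.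
pose E := Group (extender_group_set PT QT (Xiso_fas_iso PT QT isog)).
have -> : <<extender aT P Q (realize P g)>>%G = E by apply/val_inj/(genGid E).
have memE n : (n \in E) =
    (n \in 'N_T(P)) && (inner aT P n ^ g \in inner aT Q @* 'N_T(Q)).
  by rewrite -(mem_extender n PT QT isog).
have ET : E \subset T by apply/subsetP=> n; rewrite memE => /andP[/setIP[]].
have ES := subset_trans ET TS.
have PE : P \subset E.
  apply/subsetP=> n Pn; have Nn : n \in 'N(P) by apply: (subsetP (normG P)).
  have /andP[Xg /eqP PQ] := isog.
  have XgT := realize_sub (subxx P) QT PT (subxx T) Xg.
  rewrite memE (transport_inner PT (subxx P) XgT PQ) // inE Nn (subsetP PT) //=.
  have NQ := transport_norm PT (subxx P) XgT PQ Pn Nn.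
  exact: mem_morphim.
have NE : E \subset 'N_S(P).
  apply/subsetP=> n; rewrite memE => /andP[/setIP[Tn Nn] _].
  by rewrite inE Nn (subsetP TS).
have cQS := fully_Xcentralized_stab QT cQ.
have [n En | h [h2 hP Xh]] := extension_realize ext PE NE QS cQS isogS.
  have Tn := subsetP ET n En; move: En; rewrite memE inner_stab // => /andP[_].
  case/morphimP=> m _ /setIP[Tm Nm] ->; rewrite /= inner_stab //.
  by apply: mem_morphim; rewrite inE Nm (subsetP TS).
have hx : h.2 x = x by rewrite h2.
have hT := stab_image ET Xh hx.
have [hM _ _] := realize_hom ES (subxx S) Xh.
pose R := Group (perm_morph_group_set hM).
have RT : R \subset T by apply/subsetP=> _ /imsetP[n En ->]; apply: hT.
have [/andP[XhR _] _] := Xiso_corestr ES (subxx S) Xh (erefl (gval R)).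
exists (restr E h.1) => [|n Pn]; last by rewrite !ffunE Pn (subsetP PE) // hP.
rewrite /= -h2 -[(_, _)]/(realize E h) mem_stab_system h2 gx eqxx andbT.
exact: realize_sub (subxx E) RT ES TS XhR.
Qed.

Lemma stab_saturated : saturated XT p.
Proof.
apply: saturated_criterion; first exact: pgroupS TS pS.
  exact: stab_extension.
move=> P /[dup] PT /stab_representative[P0 [P0T conjP cP0 sylP0]].
exists P0; split=> // Q QT /(Fconj_stab P0T QT) conjQ.
by rewrite !centX_stab //; apply: cP0; first exact: subset_trans TS.
Qed.

End FullyStabilized.
End Stabilizer.

Theorem theorem2p6p4 (p : nat) (gT : finGroupType) (S : {group gT}) (X : finType)
    (a : left_action S X) (XX : fusion_action_system a) (x : X) :
  prime p ->
  pgroup p S ->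
  fas_transitive XX ->
  saturated XX p ->
  fully_stabilized a x ->
  saturated (stab_system x XX) p.
Proof. by move=> _ pS trX satX fsx; apply: stab_saturated. Qed.
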